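(* Let $\boldsymbol\beta=(\beta,\gamma)$ with $\gamma>0$ be such that there is a unique solution $p^*\in(0,1)$ of the equation $$p=\frac{e^{\beta+\gamma p^2}}{1+e^{\beta+\gamma p^2}},$$ and such that moreover $$\left.\frac{d}{dp}\,\frac{e^{\beta+\gamma p^2}}{1+e^{\beta+\gamma p^2}}\right|_{p=p^*}<1 .$$ For each $n$ let $\boldsymbol X^{(n)}\sim p^{(n)}_{\boldsymbol\beta}$ be an exponential random graph on $[n]$, and let $G(n,p^* )$ denote an Erdős–Rényi random graph with edge probability $p^*$. Then there is a positive constant $C_1'$, depending only on $p^*$, such that as $n\to\infty$, $$\max_{s\le \frac12\frac{\log n}{\log\gamma_{p^*}}-C_1'\log\log n}\ \max_{H_s\in\mathcal{G}(s)}\left|\frac{n_{\boldsymbol X^{(n)}}(H_s)}{\mathbb{E}\bigl(n_{G(n,p^* )}(H_s)\bigr)}-1\right|\longrightarrow 0\quad\text{almost surely.}$$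
   Context: Exponential random graph model: a simple graph on $[n]=\{1,\dots,n\}$ is encoded by $\boldsymbol x=(x_{ij})_{1\le i<j\le n}\in\{0,1\}^{\binom n2}$, with $x_{ij}=1$ iff $i,j$ are adjacent. The Hamiltonian is $H(\boldsymbol x)=\beta\sum_{1\le i<j\le n}x_{ij}+\frac{\gamma}{n}\sum_{1\le i<j<k\le n}x_{ij}x_{jk}x_{ik}$, and $p^{(n)}_{\boldsymbol\beta}$ is the probability measure on $\{0,1\}^{\binom n2}$ with $p^{(n)}_{\boldsymbol\beta}(\boldsymbol x)\propto\exp(H(\boldsymbol x))$. The graphs $\boldsymbol X^{(n)}$, $n\ge1$, are defined on a common probability space. $\mathcal{G}(s)$ is the set of all graphs with vertex set $[s]$ ($s$ a positive integer); for graphs $G,H$, $n_G(H)$ is the number of induced isomorphic copies of $H$ in $G$ (number of vertex subsets of $G$ inducing a subgraph isomorphic to $H$). $\gamma_p=\max\{p^{-1},(1-p)^{-1}\}$ (not to be confused with the parameter $\gamma$). In the Erdős–Rényi graph $G(n,p)$ each pair of vertices of $[n]$ is joined independently with probability $p$, so $\mathbb{E}(n_{G(n,p)}(H_s))=\frac{(n)_s}{|\mathrm{Aut}(H_s)|}\left(\frac{p}{1-p}\right)^{|E(H_s)|}(1-p)^{\binom s2}$ with $(n)_s=n(n-1)\cdots(n-s+1)$. $\log$ is the natural logarithm. *)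

(* Defs.v *)
From HB Require Import structures.
From mathcomp Require Import all_boot all_order all_algebra.
From mathcomp Require Import all_classical all_reals all_analysis.
Set Implicit Arguments.
Unset Strict Implicit.
Unset Printing Implicit Defensive.
Import Order.TTheory GRing.Theory Num.Theory numFieldNormedType.Exports.
Local Open Scope ring_scope.

Definition edge (n : nat) : finType := {e : 'I_n * 'I_n | (e.1 < e.2)%N}.

Definition graph (n : nat) : finType := {ffun edge n -> bool}.

Definition has_edge (n : nat) (x : graph n) (i j : 'I_n) : bool :=
  if insub (i, j) : option (edge n) is Some e then x e else false.

Definition adj (n : nat) (x : graph n) (i j : 'I_n) : bool :=
  has_edge x i j || has_edge x j i.

Definition hamiltonian (R : realType) (beta gamma : R) (n : nat)
    (x : graph n) : R :=
  beta * \sum_(i < n) \sum_(j < n | (i < j)%N) (adj x i j)%:R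
  + gamma / n%:R *
    \sum_(i < n) \sum_(j < n | (i < j)%N) \sum_(k < n | (j < k)%N)
      (adj x i j)%:R * (adj x j k)%:R * (adj x i k)%:R.

Definition ergm (R : realType) (beta gamma : R) (n : nat) (x : graph n) : R :=
  expR (hamiltonian beta gamma x)
  / \sum_(y : graph n) expR (hamiltonian beta gamma y).

Definition erdos_renyi (R : realType) (p : R) (n : nat) (x : graph n) : R :=
  \prod_(e : edge n) (if x e then p else 1 - p).

(* [f] witnesses that the subgraph of [G] induced on [A] is isomorphic to [H]. *)
Definition induces (n s : nat) (G : graph n) (A : {set 'I_n})
    (H : graph s) : bool :=
  [exists f : {ffun 'I_s -> 'I_n},
    [&& injectiveb f, f @: 'I_s == A
      & [forall i, forall j, adj G (f i) (f j) == adj H i j]]].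

Definition induced_count (n s : nat) (G : graph n) (H : graph s) : nat :=
  #|[pred A : {set 'I_n} | induces G A H]|.

Definition er_expected_count (R : realType) (p : R) (n s : nat)
    (H : graph s) : R :=
  \sum_(x : graph n) erdos_renyi p x * (induced_count x H)%:R.

Definition gamma_of (R : realType) (p : R) : R := Num.max p^-1 (1 - p)^-1.

Definition size_bound (R : realType) (p C : R) (n : nat) : R :=
  2^-1 * (ln n%:R / ln (gamma_of p)) - C * ln (ln n%:R).

(* [truncn] is the integer part, and 0 on negative reals, so [s] ranges over
   the positive integers at most [size_bound p C n]. The maximum over an empty
   range, possible only for small [n], is 0. *)
Definition max_deviation (R : realType) (p C : R) (n : nat) (G : graph n) : R :=
  \big[Num.max/0]_(1 <= s < (Num.truncn (size_bound p C n)).+1)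
    \big[Num.max/0]_(H : graph s)
      `| (induced_count G H)%:R / er_expected_count p n H - 1 |.

Definition mean_field (R : realType) (beta gamma p : R) : R :=
  expR (beta + gamma * p ^+ 2) / (1 + expR (beta + gamma * p ^+ 2)).

(* Main.v *)
Require Import Defs.
From HB Require Import structures.
From mathcomp Require Import all_boot all_order all_algebra.
From mathcomp Require Import all_classical all_reals all_analysis.
From mathcomp Require Import ring lra zify.
Import Order.TTheory GRing.Theory Num.Theory numFieldNormedType.Exports.
Local Open Scope ring_scope.

(** Write [l = ln n] and, for a graph [x] on [n] vertices, [L i j] for the
    number of common neighbours of [i] and [j] divided by [n].

    Concentration. Given all other edges, the edge [ij] of the random graph is
    present with probability [sigmoid (beta + gamma * L i j)], because toggling
    it changes the Hamiltonian by plus or minus [beta + gamma * L i j]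
    ([hamiltonian_toggle]). Hence the degree of [i], and the codegree of [i] and
    [j], differ from the corresponding sums of conditional probabilities by sums
    of terms that toggling an edge reverses in sign after weighting. Chatterjee's
    exchangeable-pair argument bounds all even moments of such sums
    ([antisym_moment_step]); a moment of order [ln n] shows that all of them are
    at most [sqrt n * l] outside an event of summable probability
    ([atypical_prob]).

    Mean-field contraction. Since [gamma > 0], the sigmoid is increasing in
    [L i j]. At a pair where [L] is maximal, with value [M], the two residual
    identities give [M <= sigmoid (beta + gamma * M) ^ 2 + O (l / sqrt n)], and
    the reverse holds for the minimal value. In the variable [q = sqrt M] this
    says that [q] is nearly a sub- or super-solution of the mean-field equation;
    uniqueness and stability of the fixed point [p] then force
    [|M - p ^ 2| = O (l / sqrt n)] ([mean_field_gap], [mean_field_sandwich]).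
    So all degrees are [p * n] and all codegrees [p ^ 2 * n] up to
    [sqrt n * l ^ 2] ([typical_regular]).

    Counting. In a graph with such degrees and codegrees, the second moment of
    the number of neighbours in a fixed set [B] shows that all but roughly
    [sqrt n], up to powers of [l], vertices have the right number of neighbours
    and of non-neighbours in [B] ([few_irregular_vertices]). One
    places the vertices of [H] one at a time and keeps, for each vertex still
    to be placed, the set of its candidates. The bound on [s] keeps these sets
    larger than [sqrt n] times a high power of [l], so that the irregular
    vertices are a negligible fraction at every step, even if each of them
    admits as many completions as the candidate sets permit ([placements_le],
    [placements_ge]). The number of labelled copies is thus
    [n ^ s * prod P (1 + o(1))] uniformly in [H], and the expectation in the
    Erdos-Renyi graph is the same product with a falling factorial, both divided
    by the number of automorphisms ([induced_count_ratio]). The Borel-Cantelli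
    lemma ([ae_eventually]) concludes. *)

Set Implicit Arguments.
Unset Strict Implicit.
Unset Printing Implicit Defensive.

(** * Moments of a sum of antisymmetric terms *)

Lemma ler_norm_subX (R : realDomainType) (a b : R) (m : nat) :
  `|a ^+ m.+1 - b ^+ m.+1| <= m.+1%:R * `|a - b| * (`|a| ^+ m + `|b| ^+ m).
Proof.
rewrite subrXX normrM mulrAC [leRHS]mulrC ler_wpM2l//.
apply: le_trans (ler_norm_sum _ _ _) _.
have -> : m.+1%:R * (`|a| ^+ m + `|b| ^+ m) =
    \sum_(i < m.+1) (`|a| ^+ m + `|b| ^+ m).
  by rewrite sumr_const card_ord mulr_natl.
apply: ler_sum => i _; rewrite normrM !normrX /=.
have : (i <= m)%N by rewrite -ltnS.
move: (nat_of_ord i) => j jm.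
have [ab|/ltW ba] := leP `|a| `|b|.
- apply: le_trans (_ : `|b| ^+ m <= _); last by rewrite lerDr exprn_ge0.
  rewrite -{2}(subnK jm) exprD ler_wpM2r ?exprn_ge0//.
  by rewrite lerXn2r ?nnegrE.
- apply: le_trans (_ : `|a| ^+ m <= _); last by rewrite lerDl exprn_ge0.
  rewrite -{2}(subnK jm) exprD ler_wpM2l ?exprn_ge0//.
  by rewrite lerXn2r ?nnegrE.
Qed.

Section AntisymmetricMoments.
Variables (R : realFieldType) (Omega K : finType) (w : Omega -> R).
Variables (D : pred K) (sigma : K -> Omega -> Omega) (u : K -> Omega -> R).
Variables (c L : R).
Hypothesis c_ge0 : 0 <= c.
Hypothesis L_ge0 : 0 <= L.
Hypothesis w_ge0 : forall x, 0 <= w x.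
Hypothesis sigmaK : forall k, involutive (sigma k).
Hypothesis u_le1 : forall k x, `|u k x| <= 1.
Hypothesis u_anti : forall k x, D k ->
  w (sigma k x) * u k (sigma k x) = - (w x * u k x).
Hypothesis w_sigma : forall k x, D k -> w (sigma k x) <= L * w x.

Let f x := \sum_(k | D k) u k x.

Hypothesis f_sigma : forall k x, D k -> `|f (sigma k x) - f x| <= c.

(** With the weight [w], each [u k] changes sign under [sigma k]. One power of
    [f] is traded for an increment of [f]: summing the
    antisymmetric weight [w * u k] against any function only sees the
    difference of that function between [x] and [sigma k x]. *)
Lemma antisym_moment_step (m : nat) :
  \sum_x w x * f x ^+ m.+1.*2 <=
  #|K|%:R * (m.*2.+1%:R * c * (1 + L)) * \sum_x w x * f x ^+ m.*2.
Proof.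
have -> : \sum_x w x * f x ^+ m.+1.*2 =
    \sum_(k | D k) \sum_x w x * u k x * f x ^+ m.*2.+1.
  rewrite exchange_big /=; apply: eq_bigr => x _.
  rewrite doubleS exprS mulrA {1}/f mulr_sumr mulr_suml.
  by apply: eq_bigr.
set S := \sum_x w x * f x ^+ m.*2.
have f_even_ge0 x : 0 <= f x ^+ m.*2 by rewrite exprn_even_ge0// odd_double.
have S_ge0 : 0 <= S by apply: sumr_ge0 => x _; rewrite mulr_ge0.
have B_ge0 : 0 <= m.*2.+1%:R * c * (1 + L) * S.
  by rewrite !mulr_ge0// addr_ge0.
have oneK k : D k -> \sum_x w x * u k x * f x ^+ m.*2.+1 <=
    m.*2.+1%:R * c * (1 + L) * S.
  move=> Dk; have sum_sigma (F : Omega -> R) : \sum_x F x = \sum_x F (sigma k x).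
    exact/reindex_inj/(can_inj (sigmaK k)).
  set Z := \sum_x _.
  (* [Z] is averaged with its image under [sigma k], whence the factor 2. *)
  suff h : Z *+ 2 <= m.*2.+1%:R * c * (1 + L) * S.
    have [Z0|/ltW Z0] := leP 0 Z; last exact: le_trans B_ge0.
    by apply: le_trans h; rewrite mulr2n lerDl.
  rewrite mulr2n {2}/Z sum_sigma -big_split /=.
  apply: le_trans (_ : \sum_x m.*2.+1%:R * c *
      (w x * f x ^+ m.*2 + w x * f (sigma k x) ^+ m.*2) <= _).
    apply: ler_sum => x _.
    rewrite u_anti// mulNr -mulrBr.
    apply: le_trans (ler_norm _) _; rewrite !normrM (ger0_norm (w_ge0 x)).
    rewrite -mulrDr mulrCA -mulrA ler_wpM2l//.
    apply: le_trans (_ : `|f x ^+ m.*2.+1 - f (sigma k x) ^+ m.*2.+1| <= _).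
      by rewrite ler_piMl.
    apply: le_trans (ler_norm_subX _ _ _) _.
    have nE y : `|f y| ^+ m.*2 = f y ^+ m.*2 by rewrite -normrX ger0_norm.
    by rewrite !nE ler_wpM2r ?addr_ge0// ler_wpM2l// distrC f_sigma.
  rewrite -mulr_sumr big_split /= -/S -[leRHS]mulrA ler_wpM2l ?mulr_ge0//.
  rewrite mulrDl mul1r lerD2l [leLHS]sum_sigma /S mulr_sumr.
  apply: ler_sum => x _; rewrite sigmaK mulrA ler_wpM2r ?w_sigma//.
apply: le_trans (ler_sum _ oneK) _; rewrite sumr_const -[leLHS]mulr_natl -[leRHS]mulrA.
by rewrite ler_wpM2r// ler_nat max_card.
Qed.

Lemma antisym_moment (M m : nat) : (m <= M)%N ->
  \sum_x w x * f x ^+ m.*2 <=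
  (#|K|%:R * (M.*2%:R * c * (1 + L))) ^+ m * \sum_x w x.
Proof.
elim: m => [|m IH] mM.
  rewrite expr0 mul1r le_eqVlt; apply/orP; left; apply/eqP.
  by apply: eq_bigr => x _; rewrite expr0 mulr1.
apply: le_trans (antisym_moment_step m) _.
rewrite exprS -[leRHS]mulrA; apply: ler_pM.
- by rewrite !mulr_ge0// addr_ge0.
- by apply: sumr_ge0 => x _; rewrite mulr_ge0// exprn_even_ge0// odd_double.
- rewrite ler_wpM2l// ler_wpM2r ?addr_ge0// ler_wpM2r// ler_nat.
  lia.
- exact/IH/ltnW.
Qed.

(** Markov's inequality for the even power [2 m] of [f]. *)
Lemma antisym_tail (m : nat) (t : R) : 0 < t ->
  \sum_(x | t < `|f x|) w x <=
  (#|K|%:R * (m.*2%:R * c * (1 + L)) / t ^+ 2) ^+ m * \sum_x w x.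
Proof.
move=> t0; have tm : 0 < t ^+ m.*2 by rewrite exprn_gt0.
rewrite expr_div_n -exprM mul2n mulrAC ler_pdivlMr//.
apply: le_trans (antisym_moment (leqnn m)).
rewrite mulr_suml [leRHS](bigID (fun x => t < `|f x|)) /=.
apply: le_trans (_ : \sum_(x | t < `|f x|) w x * f x ^+ m.*2 <= _); last first.
  rewrite lerDl; apply: sumr_ge0 => x _.
  by rewrite mulr_ge0// exprn_even_ge0// odd_double.
apply: ler_sum => x /ltW tx; rewrite ler_wpM2l//.
rewrite -(@ger0_norm _ (f x ^+ _)) ?exprn_even_ge0 ?odd_double// normrX.
by rewrite lerXn2r// nnegrE ltW.
Qed.
End AntisymmetricMoments.

(** * Toggling one edge of a graph *)

Section Toggle.
Variable n : nat.
Implicit Types (x : graph n) (a b i j k l u v : 'I_n).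

Lemma has_edge_lt x a b (ab : (a < b)%N) :
  has_edge x a b = x (Sub (a, b) ab : edge n).
Proof. by rewrite /has_edge (insubT (fun e : 'I_n * 'I_n => (e.1 < e.2)%N)). Qed.

Lemma has_edge_ge x a b : (b <= a)%N -> has_edge x a b = false.
Proof. by move=> ba; rewrite /has_edge insubF//= ltnNge ba. Qed.

Lemma adj_sym x a b : adj x a b = adj x b a.
Proof. by rewrite /adj orbC. Qed.

Lemma adj_irrefl x a : adj x a a = false.
Proof. by rewrite /adj has_edge_ge. Qed.

Definition same_pair i k a b : bool :=
  ((a == i) && (b == k)) || ((a == k) && (b == i)).

Definition toggle i k x : graph n :=
  [ffun e => x e (+) same_pair i k (val e).1 (val e).2].

Lemma toggleK i k : involutive (toggle i k).
Proof. by move=> x; apply/ffunP => e; rewrite !ffunE addbK. Qed.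

Lemma adj_toggle x i k a b : i != k ->
  adj (toggle i k x) a b = adj x a b (+) same_pair i k a b.
Proof.
move=> ik; wlog ab : a b / (a <= b)%N => [H|].
  have [/H//|/ltnW/H ba] := leqP a b.
  by rewrite adj_sym ba adj_sym /same_pair orbC andbC (andbC (_ == k)).
have [eq_ab|lt_ab] := eqVneq a b.
  subst b; rewrite !adj_irrefl /same_pair.
  by case: eqP => [->|]; rewrite ?(negbTE ik)//= andbF.
have {lt_ab}ab' : (a < b)%N by rewrite ltn_neqAle ab andbT.
by rewrite /adj !(has_edge_lt _ ab') !(has_edge_ge _ (ltnW ab')) !orbF ffunE.
Qed.

Lemma toggle_sym i k x : toggle i k x = toggle k i x.
Proof. by apply/ffunP => e; rewrite !ffunE /same_pair orbC. Qed.

End Toggle.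

Section Hamiltonian.
Variables (R : realType) (n : nat).
Implicit Types (x : graph n) (i j k l u v : 'I_n).

Definition adjr x i j : R := (adj x i j)%:R.

Definition degree x i : R := \sum_l adjr x i l.

Definition codegree x i j : R := \sum_l adjr x i l * adjr x j l.

Lemma adjr_sym x i j : adjr x i j = adjr x j i.
Proof. by rewrite /adjr adj_sym. Qed.

Lemma adjr_irrefl x i : adjr x i i = 0.
Proof. by rewrite /adjr adj_irrefl. Qed.

Lemma codegree_sym x i j : codegree x i j = codegree x j i.
Proof. by apply: eq_bigr => l _; rewrite mulrC. Qed.

Lemma adjr_bound x i j : 0 <= adjr x i j <= 1.
Proof. by rewrite /adjr; case: adj => /=; rewrite ?lexx ?ler01. Qed.

Lemma sum_pair_delta (F : 'I_n -> 'I_n -> R) u v :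
  \sum_i \sum_j ((i == u) && (j == v))%:R * F i j = F u v.
Proof.
rewrite (bigD1 u)//= [X in _ + X]big1 => [|i /negbTE iu]; last first.
  by apply: big1 => j _; rewrite iu mul0r.
rewrite (bigD1 v)//= [X in _ + X + _]big1 => [|j /negbTE jv]; last first.
  by rewrite jv andbF mul0r.
by rewrite !eqxx mul1r !addr0.
Qed.

Lemma adjr_toggle_lt x u v i j : (u < v)%N -> (i < j)%N ->
  adjr (toggle u v x) i j =
  adjr x i j + ((i == u) && (j == v))%:R * (1 - 2 * adjr x u v).
Proof.
move=> uv ij; have uv' : u != v by apply: contraTneq uv => ->; rewrite ltnn.
rewrite /adjr adj_toggle// /same_pair.
have -> : ((i == v) && (j == u)) = false.
  by apply: contraTF ij => /andP[/eqP-> /eqP->]; rewrite -leqNgt ltnW.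
rewrite orbF; case: eqP => [->|]; case: eqP => [->|] //=.
all: rewrite ?mul0r ?addr0 ?addbF// addbT mul1r.
by case: adj => /=; lra.
Qed.

Lemma sum_lt_delta2 (F : 'I_n -> 'I_n -> R) u v : (u < v)%N ->
  \sum_(i < n) \sum_(j < n | (i < j)%N) ((i == u) && (j == v))%:R * F i j = F u v.
Proof.
move=> uv; rewrite -(sum_pair_delta F u v); apply: eq_bigr => i _.
rewrite big_mkcond; apply: eq_bigr => j _; case: ifP => // /negbT ij.
case: eqP => [iu|]; case: eqP => [jv|] //=; rewrite ?mul0r//.
by rewrite iu jv uv in ij.
Qed.

(** Only triangles through [uv] are affected, and their third vertex is a common
    neighbour of [u] and [v]. As the sum runs over increasing triples, the third
    vertex lies above, below or between [u] and [v], which gives three sums. *)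
Lemma triangles_toggle x u v : (u < v)%N ->
  \sum_(i < n) \sum_(j < n | (i < j)%N) \sum_(k < n | (j < k)%N)
    adjr (toggle u v x) i j * adjr (toggle u v x) j k * adjr (toggle u v x) i k =
  \sum_(i < n) \sum_(j < n | (i < j)%N) \sum_(k < n | (j < k)%N)
    adjr x i j * adjr x j k * adjr x i k +
  (1 - 2 * adjr x u v) * codegree x u v.
Proof.
move=> uv; have [e eE] : exists e : R, e = 1 - 2 * adjr x u v by eexists.
rewrite -eE.
pose d i j : R := ((i == u) && (j == v))%:R.
have split3 i j k : (i < j)%N -> (j < k)%N ->
    adjr (toggle u v x) i j * adjr (toggle u v x) j k * adjr (toggle u v x) i k =
    adjr x i j * adjr x j k * adjr x i k +
    (d i j * (e * (adjr x j k * adjr x i k)) +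
     d j k * (e * (adjr x i j * adjr x i k)) +
     d i k * (e * (adjr x i j * adjr x j k))).
  move=> ij jk; have ik := ltn_trans ij jk.
  rewrite !adjr_toggle_lt// -eE -!/(d _ _).
  have d0 a b c f : (a == c) && (b == f) = false ->
      ((a == u) && (b == v)) && ((c == u) && (f == v)) = false.
    by apply: contraFF => /andP[/andP[/eqP-> /eqP->] /andP[/eqP-> /eqP->]]; rewrite !eqxx.
  have prod0 (b c : bool) : b && c = false -> b%:R * c%:R = 0 :> R.
    by case: b; case: c => //; rewrite ?mul0r ?mulr0.
  (* An increasing triple contains the pair [uv] at most once. *)
  have h1 : d i j * d j k = 0.
    by apply/prod0/d0; rewrite -val_eqE /= (ltn_eqF ij).
  have h2 : d i j * d i k = 0.
    by apply/prod0/d0; rewrite eqxx -val_eqE /= (ltn_eqF jk).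
  have h3 : d j k * d i k = 0.
    by apply/prod0/d0; rewrite -val_eqE /= (gtn_eqF ij).
  apply/eqP; rewrite -subr_eq0; apply/eqP.
  transitivity (d i j * d j k * (e ^+ 2 * (adjr x i k + d i k * e)) +
    d i j * d i k * (e ^+ 2 * adjr x j k) +
    d j k * d i k * (e ^+ 2 * adjr x i j)); first by ring.
  by rewrite h1 h2 h3 !mul0r !addr0.
under eq_bigr => i _ do under eq_bigr => j ij do under eq_bigr => k jk do
  rewrite (split3 _ _ _ ij jk).
under eq_bigr => i _ do (under eq_bigr => j ij do rewrite big_split); rewrite /=.
under eq_bigr => i _ do rewrite big_split /=.
rewrite big_split /=; congr (_ + _).
transitivity (\sum_(k < n) ((v < k)%N%:R + (k < u)%N%:R + ((u < k) && (k < v))%N%:R) *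
   (e * (adjr x u k * adjr x v k))).
  under eq_bigr => i _ do under eq_bigr => j ij do rewrite !big_split /=.
  under eq_bigr => i _ do rewrite !big_split /=.
  rewrite !big_split /=.
  under [RHS]eq_bigr => k _ do rewrite !mulrDl.
  rewrite !big_split /=; congr (_ + _ + _).
  - under eq_bigr => i _ do under eq_bigr => j _ do rewrite -mulr_sumr.
    rewrite sum_lt_delta2// big_mkcond /=; apply: eq_bigr => k _.
    by case: ifP => _; rewrite ?mul0r// mul1r; congr (_ * _); rewrite mulrC.
  - apply: eq_bigr => i _.
    rewrite [adjr x u i]adjr_sym [adjr x v i]adjr_sym.
    rewrite -(sum_lt_delta2 (fun j k => (i < j)%N%:R *
      (e * (adjr x i j * adjr x i k))) uv) big_mkcond.
    apply: eq_bigr => j _; case: ifP => _; last first.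
      by rewrite big1// => k _; rewrite mul0r mulr0.
    by apply: eq_bigr => k _; rewrite mul1r.
  - transitivity (\sum_(j < n) \sum_(i < n) \sum_(k < n) d i k *
      (((i < j) && (j < k))%N%:R * (e * (adjr x i j * adjr x j k)))).
      rewrite exchange_big /=; apply: eq_bigr => i _.
      rewrite big_mkcond; apply: eq_bigr => j _; case: ifP => _; last first.
        by rewrite big1// => k _; rewrite mul0r mulr0.
      rewrite big_mkcond; apply: eq_bigr => k _; case: ifP => _.
        by rewrite mul1r.
      by rewrite mul0r mulr0.
    by apply: eq_bigr => j _; rewrite sum_pair_delta [adjr x v j]adjr_sym.
rewrite /codegree mulr_sumr; apply: eq_bigr => k _.
have [ku|ku] := eqVneq k u; first by rewrite ku adjr_irrefl mul0r !mulr0.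
have [kv|kv] := eqVneq k v; first by rewrite kv adjr_irrefl !mulr0.
suff -> : ((v < k)%N%:R + (k < u)%N%:R + ((u < k) && (k < v))%N%:R) = 1 :> R by rewrite mul1r.
have [vk|_|/val_inj h] := ltngtP v k; last by rewrite h eqxx in kv.
- by rewrite (ltn_trans uv vk) ltnNge (ltnW (ltn_trans uv vk)) /= !addr0.
- have [uk|uk|/val_inj h] := ltngtP u k; rewrite /= ?addr0 ?add0r//.
  by rewrite h eqxx in ku.
Qed.

Lemma codegree_toggle x i k : i != k ->
  codegree (toggle i k x) i k = codegree x i k.
Proof.
move=> ik; apply: eq_bigr => l _; rewrite /adjr !adj_toggle//.
have -> : same_pair i k i l = (l == k) by rewrite /same_pair eqxx (negbTE ik) orbF.
have -> : same_pair i k k l = (l == i).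
  by rewrite /same_pair eqxx eq_sym (negbTE ik).
have [->|lk] := eqVneq l k.
  by rewrite adj_irrefl eq_sym (negbTE ik) !mulr0.
by have [->|li] := eqVneq l i; rewrite ?adj_irrefl ?addbF ?mul0r.
Qed.

(** The log-odds of the edge [uv] given the rest of the graph; by
    [codegree_toggle] they do not depend on the edge itself. *)
Lemma hamiltonian_toggle (beta gamma : R) x u v : u != v ->
  hamiltonian beta gamma (toggle u v x) = hamiltonian beta gamma x +
  (1 - 2 * adjr x u v) * (beta + gamma / n%:R * codegree x u v).
Proof.
wlog uv : u v / (u < v)%N => [H uv|_].
  have [lt|] := ltnP u v; first exact: H.
  rewrite leq_eqVlt => /orP[/eqP/val_inj h|lt]; first by rewrite h eqxx in uv.
  by rewrite toggle_sym H 1?eq_sym// adjr_sym codegree_sym.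
rewrite /hamiltonian (triangles_toggle x uv).
have -> : \sum_(i < n) \sum_(j < n | (i < j)%N) ((adj (toggle u v x) i j)%:R : R) =
    \sum_(i < n) \sum_(j < n | (i < j)%N) ((adj x i j)%:R : R) + (1 - 2 * adjr x u v).
  rewrite -(sum_lt_delta2 (fun _ _ => 1 - 2 * adjr x u v) uv) -big_split.
  apply: eq_bigr => i _; rewrite -big_split; apply: eq_bigr => j ij /=.
  by have := adjr_toggle_lt x uv ij; rewrite /adjr.
rewrite -/(adjr _ _ _); set A := \sum_(i < n) _; set B := \sum_(i < n) _.
by ring.
Qed.

End Hamiltonian.

(** * The logistic function *)

Section Sigmoid.
Variable R : realType.
Implicit Types a b z : R.

Definition sigmoid z : R := expR z / (1 + expR z).

Lemma sigmoid_gt0 z : 0 < sigmoid z.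
Proof. by rewrite divr_gt0 ?addr_gt0 ?expR_gt0. Qed.

Lemma sigmoid_lt1 z : sigmoid z < 1.
Proof. by rewrite ltr_pdivrMr ?addr_gt0 ?expR_gt0// mul1r ltrDr. Qed.

Lemma sigmoid_diff a b : a <= b -> 0 <= sigmoid b - sigmoid a <= b - a.
Proof.
move=> ab; have A0 := expR_gt0 a; have B0 := expR_gt0 b.
have AB : expR a <= expR b by rewrite ler_expR.
have E : sigmoid b - sigmoid a =
    (expR b - expR a) / ((1 + expR a) * (1 + expR b)).
  rewrite /sigmoid; field; apply/andP; split; lra.
rewrite E; apply/andP; split.
  by rewrite divr_ge0 ?mulr_ge0 ?subr_ge0//; lra.
have d0 : 0 < (1 + expR a) * (1 + expR b) by apply: mulr_gt0; lra.
rewrite ler_pdivrMr//.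
have := expR_ge1Dx (a - b); rewrite expRD expRN => h.
have {}h : (1 + (a - b)) * expR b <= expR a.
  by rewrite -ler_pdivlMr.
have : 0 <= (b - a) * (1 + expR a + expR a * expR b).
  by rewrite mulr_ge0 ?subr_ge0// addr_ge0 ?mulr_ge0//; lra.
lra.
Qed.

Lemma sigmoid_lip a b : `|sigmoid a - sigmoid b| <= `|a - b|.
Proof.
wlog ab : a b / a <= b => [H|].
  have [/H//|/ltW/H] := leP a b.
  by rewrite distrC [in leRHS]distrC.
have /andP[h1 h2] := sigmoid_diff ab.
by rewrite distrC [leRHS]distrC !ger0_norm ?subr_ge0// -subr_ge0.
Qed.

Lemma sigmoid_mono a b : a <= b -> sigmoid a <= sigmoid b.
Proof. by move=> /sigmoid_diff/andP[]; rewrite subr_ge0. Qed.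

End Sigmoid.

(** * Concentration of edge sums around their conditional means *)

Section Residuals.
Variables (R : realType) (beta gamma : R) (n : nat).
Hypothesis gamma_ge0 : 0 <= gamma.
Implicit Types (x : graph n) (i j k l : 'I_n).

(** The conditional probability of the edge [ik] given all other edges. *)
Definition edge_prob x i k : R :=
  sigmoid (beta + gamma / n%:R * codegree R x i k).

(** With [g = 1] this compares the degree of [i] with its conditional mean; with
    [g k = adjr j k] it compares the codegree of [i] and [j] with the sum in
    which each edge [ik] is replaced by its conditional probability. *)
Definition residual (g : 'I_n -> graph n -> R) i x : R :=
  \sum_(k | k != i) (adjr R x i k - edge_prob x i k) * g k x.

Lemma codegree_bound x i k : 0 <= codegree R x i k <= n%:R.
Proof.
apply/andP; split.
  by apply: sumr_ge0 => l _; rewrite mulr_ge0// /adjr.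
rewrite -[n in leRHS]card_ord -sum1_card natr_sum; apply: ler_sum => l _.
have /andP[a0 a1] := adjr_bound R x i l; have /andP[b0 b1] := adjr_bound R x k l.
by apply: mulr_ile1.
Qed.

Lemma same_pair_fst i k m : i != k -> same_pair i k i m = (m == k).
Proof. by move=> ik; rewrite /same_pair eqxx (negbTE ik) orbF. Qed.

Lemma same_pair_other i k l m : i != l ->
  same_pair i k l m = (l == k) && (m == i).
Proof. by move=> il; rewrite /same_pair eq_sym (negbTE il). Qed.

Lemma adjr_toggle_diff x i k a b : i != k ->
  `|adjr R (toggle i k x) a b - adjr R x a b| = (same_pair i k a b)%:R.
Proof.
move=> ik; rewrite /adjr adj_toggle//.
case: adj; case: same_pair => /=; rewrite ?subrr ?normr0 ?sub0r ?subr0//.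
all: by rewrite ?normrN normr1.
Qed.

Lemma codegree_toggle_diff x i k l : i != k -> i != l ->
  `|codegree R (toggle i k x) i l - codegree R x i l| <= 2.
Proof.
move=> ik il; rewrite /codegree -sumrB.
apply: le_trans (ler_norm_sum _ _ _) _.
apply: le_trans (_ : \sum_m ((m == k)%:R + (m == i)%:R) <= _); last first.
  rewrite big_split /= -!natr_sum -!big_mkcond /= !sum1_card.
  by rewrite -natrD ler_nat !cardE /= !enum1.
apply: ler_sum => m _.
set a' := adjr _ _ _ _; set b' := adjr _ _ _ _.
set a := adjr _ _ _ _; set b := adjr _ _ _ _.
have -> : a' * b' - a * b = (a' - a) * b' + a * (b' - b) by ring.
apply: le_trans (ler_normD _ _) _; rewrite !normrM.
have nb y z : `|adjr R y z m| <= 1.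
  by have /andP[h0 h1] := adjr_bound R y z m; rewrite ger0_norm.
apply: lerD.
  apply: le_trans (ler_piMr _ (nb _ _)) _ => //.
  by rewrite adjr_toggle_diff// same_pair_fst.
apply: le_trans (ler_piMl _ (nb _ _)) _ => //.
rewrite adjr_toggle_diff// same_pair_other// ler_nat.
by case: (l == k).
Qed.

Lemma edge_prob_toggle_diff x i k l : i != k -> i != l ->
  `|edge_prob (toggle i k x) i l - edge_prob x i l| <= 2 * gamma / n%:R.
Proof.
move=> ik il; apply: le_trans (sigmoid_lip _ _) _.
rewrite opprD addrACA subrr add0r -mulrBr normrM ger0_norm ?divr_ge0//.
by rewrite mulrAC (mulrC 2) ler_wpM2r ?invr_ge0// ler_wpM2l// codegree_toggle_diff.
Qed.

Definition toggle_ratio : R := expR (`|beta| + gamma).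

Lemma weight_toggle x i k : i != k ->
  expR (hamiltonian beta gamma (toggle i k x)) <=
  toggle_ratio * expR (hamiltonian beta gamma x).
Proof.
move=> ik; rewrite hamiltonian_toggle// expRD mulrC ler_wpM2r ?expR_ge0//.
rewrite ler_expR; apply: le_trans (ler_norm _) _; rewrite normrM.
have n0 : 0 < n%:R :> R by rewrite ltr0n (leq_ltn_trans _ (ltn_ord i)).
have -> : `|1 - 2 * adjr R x i k| = 1.
  by rewrite /adjr; case: adj; rewrite /= ?mulr0 ?subr0 ?normr1// mulr1
    opprD addrA subrr sub0r normrN1.
rewrite mul1r; apply: le_trans (ler_normD _ _) _; rewrite lerD2l.
have /andP[c0 c1] := codegree_bound x i k.
rewrite normrM !ger0_norm ?divr_ge0//.
by rewrite mulrAC ler_pdivrMr// ler_wpM2l.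
Qed.

(** Detailed balance for resampling the edge [ik]: the weights of the two states
    of the edge are in the ratio of their conditional probabilities. *)
Lemma weight_residual_anti x i k : i != k ->
  expR (hamiltonian beta gamma (toggle i k x)) *
    (adjr R (toggle i k x) i k - edge_prob (toggle i k x) i k) =
  - (expR (hamiltonian beta gamma x) * (adjr R x i k - edge_prob x i k)).
Proof.
move=> ik; rewrite hamiltonian_toggle// /edge_prob codegree_toggle//.
set z := beta + _; rewrite /adjr adj_toggle// same_pair_fst// eqxx addbT.
have z0 := expR_gt0 z; rewrite expRD /sigmoid; case: adj => /=.
  have -> : (1 - 2 * 1) * z = - z by ring.
  rewrite expRN; field; apply/andP; split; lra.
rewrite mulr0 subr0 mul1r; field; lra.
Qed.

Variable g : 'I_n -> graph n -> R.
Hypothesis g_bound : forall k x, 0 <= g k x <= 1.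

Lemma residual_term_le1 x i k :
  `|(adjr R x i k - edge_prob x i k) * g k x| <= 1.
Proof.
have /andP[g0 g1] := g_bound k x; have /andP[a0 a1] := adjr_bound R x i k.
have p0 : 0 < edge_prob x i k by exact: sigmoid_gt0.
have p1 : edge_prob x i k < 1 by exact: sigmoid_lt1.
rewrite normrM; apply: mulr_ile1 => //; last by rewrite ger0_norm.
rewrite ler_norml; apply/andP; split; lra.
Qed.

Variable i : 'I_n.
Hypothesis g_toggle : forall k l x, k != i -> l != i ->
  g l (toggle i k x) = g l x.

(** Toggling one edge at [i] changes the corresponding term by at most 1, and
    each of the [n] conditional probabilities by at most [2 * gamma / n]. *)
Lemma residual_toggle_diff x k : k != i ->
  `|residual g i (toggle i k x) - residual g i x| <= 1 + 2 * gamma.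
Proof.
move=> ki; have ik : i != k by rewrite eq_sym.
rewrite /residual -sumrB; apply: le_trans (ler_norm_sum _ _ _) _.
have n0 : 0 < n%:R :> R by rewrite ltr0n (leq_ltn_trans _ (ltn_ord i)).
apply: le_trans (_ : \sum_l ((l == k)%:R + 2 * gamma / n%:R) <= _); last first.
  rewrite big_split /= sumr_const card_ord -natr_sum -big_mkcond /= sum1_card.
  rewrite card1 lerD2l -mulr_natr le_eqVlt; apply/orP; left; apply/eqP.
  by field; lra.
rewrite big_mkcond /=; apply: ler_sum => l _; case: ifP => [li|_]; last first.
  by rewrite addr_ge0// divr_ge0// mulr_ge0.
have il : i != l by rewrite eq_sym.
rewrite g_toggle// -mulrBl normrM.
have /andP[g0 g1] := g_bound l x; rewrite (ger0_norm g0).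
apply: le_trans (ler_piMr _ g1) _ => //.
have swap (a b c d : R) : a - b - (c - d) = a - c - (b - d) by ring.
rewrite swap.
apply: le_trans (ler_normB _ _) _; apply: lerD.
  by rewrite adjr_toggle_diff// same_pair_fst.
by rewrite edge_prob_toggle_diff.
Qed.

Definition residual_const : R := (1 + 2 * gamma) * (1 + toggle_ratio).

Lemma residual_tail (m : nat) (t : R) : 0 < t ->
  \sum_(x | t < `|residual g i x|) ergm beta gamma x <=
  (n%:R * (m.*2%:R * residual_const) / t ^+ 2) ^+ m.
Proof.
move=> t0; rewrite /ergm -mulr_suml.
have Z0 : 0 < \sum_(y : graph n) expR (hamiltonian beta gamma y).
  rewrite (bigD1 [ffun=> false])//= ltr_wpDr ?expR_gt0//.
  by apply: sumr_ge0 => y _; exact: expR_ge0.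
rewrite ler_pdivrMr//.
have h := @antisym_tail R (graph n) 'I_n
  (fun x => expR (hamiltonian beta gamma x)) (fun k => k != i)
  (toggle i) (fun k x => (adjr R x i k - edge_prob x i k) * g k x)
  (1 + 2 * gamma) toggle_ratio _ _ _ _ _ _ _ _ m t t0.
rewrite card_ord in h; rewrite /residual_const [m.*2%:R * _]mulrA.
apply: h.
- by rewrite addr_ge0// mulr_ge0.
- exact: expR_ge0.
- by move=> x; exact: expR_ge0.
- by move=> k; exact: toggleK.
- by move=> k x; exact: residual_term_le1.
- move=> k x ki; have ik : i != k by rewrite eq_sym.
  by rewrite g_toggle// mulrA weight_residual_anti// mulNr mulrA.
- by move=> k x ki; rewrite weight_toggle// eq_sym.
- by move=> k x; exact: residual_toggle_diff.
Qed.

End Residuals.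

(** * Counting placements in a pseudo-random structure *)

Lemma sqrS_ge (m : nat) : (m ^ 2 + m.+1 <= m.+1 ^ 2)%N.
Proof. by rewrite -[m.+1]addn1 sqrnD muln1; lia. Qed.

Section Placements.
Variables (V : finType) (nb : bool -> V -> {set V}).

(** The colour [c i j] prescribes which of the two neighbourhoods of the vertex
    placed at [i] contains the vertex placed at [j]. *)
Definition placements m (c : 'I_m -> 'I_m -> bool) (B : 'I_m -> {set V}) :
    {set {ffun 'I_m -> V}} :=
  [set f : {ffun 'I_m -> V} | [forall j, f j \in B j] &&
    [forall i : 'I_m, forall j : 'I_m, (i < j)%N ==> (f j \in nb (c i j) (f i))]].

Lemma placements0 c B : #|@placements 0 c B| = 1%N.
Proof.
rewrite (_ : placements c B = [set: {ffun 'I_0 -> V}]).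
  by rewrite cardsT card_ffun card_ord.
apply/setP => f; rewrite !inE; apply/andP; split; apply/forallP.
  by case.
by case.
Qed.

Definition shift_colour m (c : 'I_m.+1 -> 'I_m.+1 -> bool) (i j : 'I_m) : bool :=
  c (lift ord0 i) (lift ord0 j).

Definition shrink m (c : 'I_m.+1 -> 'I_m.+1 -> bool) (B : 'I_m.+1 -> {set V})
    (v : V) (j : 'I_m) : {set V} :=
  nb (c ord0 (lift ord0 j)) v :&: B (lift ord0 j).

Definition ffun_cons m (u : V * {ffun 'I_m -> V}) : {ffun 'I_m.+1 -> V} :=
  [ffun i => oapp u.2 u.1 (unlift ord0 i)].

Lemma ffun_cons_bij m : bijective (@ffun_cons m).
Proof.
exists (fun f : {ffun 'I_m.+1 -> V} =>
  (f ord0, [ffun i : 'I_m => f (lift ord0 i)])) => [[v f]|f].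
  congr pair; first by rewrite ffunE unlift_none.
  by apply/ffunP => i; rewrite !ffunE liftK.
apply/ffunP => i; rewrite ffunE /=.
by case: (unliftP ord0 i) => [j|] ->; rewrite ?liftK ?unlift_none /= ?ffunE.
Qed.

Lemma placementsS m (c : 'I_m.+1 -> 'I_m.+1 -> bool) B :
  #|placements c B| =
  \sum_(v in B ord0) #|placements (shift_colour c) (shrink c B v)|.
Proof.
under eq_bigr => v _ do rewrite -sum1_card.
rewrite -sum1_card (reindex (@ffun_cons m)) /=; last first.
  exact/onW_bij/ffun_cons_bij.
rewrite pair_big_dep /=; apply: eq_bigl => -[v f] /=.
have f0 : ffun_cons (v, f) ord0 = v by rewrite ffunE unlift_none.
have fS j : ffun_cons (v, f) (lift ord0 j) = f j by rewrite ffunE liftK.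
rewrite !inE; apply/andP/and3P => [[/forallP fB /forallP fc]|].
  split; first by rewrite -f0; exact: fB.
    apply/forallP => j; rewrite inE -fS -{2}f0 andbC fB /=.
    by have /forallP/(_ (lift ord0 j))/implyP := fc ord0; apply.
  apply/forallP => i; apply/forallP => j; apply/implyP => ij.
  have /forallP/(_ (lift ord0 j))/implyP := fc (lift ord0 i).
  by rewrite !fS; apply; rewrite !lift0 ltnS.
move=> [vB /forallP fB /forallP fc]; split; apply/forallP => i.
  case: (unliftP ord0 i) => [j|] ->; rewrite ?f0// fS.
  by have := fB j; rewrite inE => /andP[].
apply/forallP => j; apply/implyP.
case: (unliftP ord0 j) => [j'|] -> //; case: (unliftP ord0 i) => [i'|] -> //.
  rewrite !lift0 ltnS !fS => ij.
  by have /forallP/(_ j')/implyP := fc i'; apply.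
by move=> _; rewrite f0 fS; have := fB j'; rewrite inE => /andP[].
Qed.

Variables (R : realType) (P : bool -> R) (q eps h kap : R).

Definition colour_weight m (c : 'I_m -> 'I_m -> bool) : R :=
  \prod_(i < m) \prod_(j < m | (i < j)%N) P (c i j).

Lemma colour_weightS m (c : 'I_m.+1 -> 'I_m.+1 -> bool) :
  colour_weight c =
  (\prod_(j < m) P (c ord0 (lift ord0 j))) * colour_weight (shift_colour c).
Proof.
rewrite /colour_weight big_ord_recl; congr (_ * _).
  by rewrite big_mkcond big_ord_recl /= mul1r; apply: eq_bigr.
apply: eq_bigr => i _; rewrite big_mkcond big_ord_recl /= mul1r [RHS]big_mkcond.
by apply: eq_bigr => j _; rewrite /bump /= ltnS.
Qed.

Hypothesis q_gt0 : 0 < q.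
Hypothesis P_bound : forall c, q <= P c <= 1.
Hypothesis eps_gt0 : 0 < eps.
Hypothesis eps_lt1 : eps < 1.
Hypothesis h_ge0 : 0 <= h.
Hypothesis kap_ge0 : 0 <= kap.

(** Only sets that are not too small need be met by most neighbourhoods in
    the expected proportion; [b] is an upper bound for the size of the set, and
    the allowed error is proportional to [b]. *)
Hypothesis few_irregular : forall c (B : {set V}) (b : R),
  h <= b -> #|B|%:R <= b ->
  #|[set v | eps * P c * b < `| #|nb c v :&: B|%:R - P c * #|B|%:R | ]|%:R <= kap.

Let P_gt0 c : 0 < P c.
Proof. by have /andP[/(lt_le_trans q_gt0)] := P_bound c. Qed.

Let P_le1 c : P c <= 1.
Proof. by have /andP[] := P_bound c. Qed.

Lemma colour_weight_ge0 m (c : 'I_m -> 'I_m -> bool) : 0 <= colour_weight c.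
Proof. by apply: prodr_ge0 => i _; apply: prodr_ge0 => j _; exact: ltW. Qed.

(** Vertices that are exceptional for the candidate set of some later place. *)
Definition irregular m (c : 'I_m.+1 -> 'I_m.+1 -> bool) (B : 'I_m.+1 -> {set V})
    (b : 'I_m.+1 -> R) : {set V} :=
  \bigcup_(j < m) [set v | eps * P (c ord0 (lift ord0 j)) * b (lift ord0 j) <
    `| #|shrink c B v j|%:R - P (c ord0 (lift ord0 j)) * #|B (lift ord0 j)|%:R | ].

Lemma card_irregular m (c : 'I_m.+1 -> 'I_m.+1 -> bool)
    (B : 'I_m.+1 -> {set V}) (b : 'I_m.+1 -> R) :
  (forall j, h <= b j) -> (forall j, #|B j|%:R <= b j) ->
  #|irregular c B b|%:R <= m%:R * kap.
Proof.
move=> hb Bb; rewrite /irregular.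
apply: le_trans (_ : \sum_(j < m) kap <= _); last first.
  by rewrite sumr_const card_ord mulr_natl.
elim/big_rec2: _ => [|j y A _ IH]; first by rewrite cards0.
apply: (@le_trans _ _ (kap + #|A|%:R)); last by rewrite lerD2l.
apply: le_trans (lerD (few_irregular _ (hb (lift ord0 j)) (Bb (lift ord0 j))) (lexx _)).
by rewrite -natrD ler_nat cardsU; exact: leq_subr.
Qed.

Lemma regular_shrink m (c : 'I_m.+1 -> 'I_m.+1 -> bool)
    (B : 'I_m.+1 -> {set V}) (b : 'I_m.+1 -> R) v j :
  v \notin irregular c B b ->
  `| #|shrink c B v j|%:R - P (c ord0 (lift ord0 j)) * #|B (lift ord0 j)|%:R | <=
  eps * P (c ord0 (lift ord0 j)) * b (lift ord0 j).
Proof.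
move=> vI; rewrite leNgt; apply: contra vI => vj.
by apply/bigcupP; exists j; rewrite ?inE.
Qed.

(** The least factor by which a regular step can shrink the recorded sizes [b]. *)
Let r := (1 - eps) * q.

Let r_gt0 : 0 < r. Proof. by rewrite mulr_gt0// subr_gt0. Qed.

Let r_le_P c : r <= (1 - eps) * P c.
Proof.
by have /andP[qP _] := P_bound c; rewrite ler_wpM2l// subr_ge0 ltW.
Qed.

Let r_le1 : r <= 1.
Proof.
apply: le_trans (r_le_P true) _; apply: mulr_ile1 => //.
- by rewrite subr_ge0 ltW.
- exact: ltW.
- by rewrite gerBl ltW.
Qed.

Lemma prod_P_ge m (c : 'I_m.+1 -> 'I_m.+1 -> bool) :
  r ^+ m.+1 <= \prod_(j < m) P (c ord0 (lift ord0 j)).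
Proof.
apply: le_trans (_ : r ^+ m <= _).
  by rewrite exprS ler_piMl// exprn_ge0// ltW.
rewrite -[m in r ^+ m]card_ord -prodr_const; apply: ler_prod => j _.
rewrite ltW//=; apply: le_trans (r_le_P (c ord0 (lift ord0 j))) _.
by rewrite ler_piMl// ?gerBl// ltW.
Qed.

Lemma le_scaled (m : nat) (b : R) : h <= b * r ^+ m -> h <= b.
Proof.
move=> hb; have rm : 0 < r ^+ m by rewrite exprn_gt0.
have b0 : 0 <= b by rewrite -(pmulr_lge0 _ rm) (le_trans h_ge0).
by apply: le_trans hb _; rewrite ler_piMr// exprn_ile1// ltW.
Qed.

(** Vertices with a large neighbourhood are dangerous for the upper bound: each
    of them may allow all candidates at every later place. There are at most
    [eps * h] of them, and [h] is at most the number of candidates times all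
    factors [P] that such a vertex can save. *)
Lemma placements_le m (c : 'I_m -> 'I_m -> bool) (B : 'I_m -> {set V}) (b : 'I_m -> R) :
  m%:R * kap <= eps * h ->
  (forall j, #|B j|%:R <= b j) -> (forall j, h <= b j * r ^+ m) ->
  #|placements c B|%:R <= (1 + eps) ^+ (m ^ 2) * \prod_j b j * colour_weight c.
Proof.
elim: m => [|m IH] in c B b * => mk Bb hb.
  by rewrite placements0 /colour_weight !big_ord0 !mulr1.
have e1 : 1 <= 1 + eps by rewrite lerDl ltW.
have mk' : m%:R * kap <= eps * h.
  by apply: le_trans mk; rewrite ler_wpM2r// ler_nat.
have hb1 j : h <= b j by exact: le_scaled (hb j).
have b0 j : 0 <= b j by exact: le_trans (hb1 j).
set Q := \prod_(j < m) P (c ord0 (lift ord0 j)).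
have Q0 : 0 <= Q by apply: prodr_ge0 => j _; exact: ltW.
set W := colour_weight (shift_colour c).
have W0 : 0 <= W by exact: colour_weight_ge0.
set Y := (1 + eps) ^+ (m ^ 2) * \prod_(j < m) b (lift ord0 j) * W.
have Y0 : 0 <= Y.
  rewrite !mulr_ge0// ?prodr_ge0// exprn_ge0//; lra.
have step v : #|placements (shift_colour c) (shrink c B v)|%:R <=
    Y * ((1 + eps) ^+ m * Q + (v \in irregular c B b)%:R).
  have [vI|vI] := boolP (v \in irregular c B b).
    apply: le_trans (_ : Y <= _); last first.
      by rewrite ler_peMr// lerDr mulr_ge0// exprn_ge0//; lra.
    apply: IH => // j.
      by apply: le_trans (Bb (lift ord0 j)); rewrite ler_nat subset_leq_card ?subsetIr.
    apply: le_trans (hb (lift ord0 j)) _; rewrite exprS ler_wpM2l//.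
    by rewrite ler_piMl// exprn_ge0// ltW.
  rewrite addr0.
  pose b' j := (1 + eps) * P (c ord0 (lift ord0 j)) * b (lift ord0 j).
  have -> : Y * ((1 + eps) ^+ m * Q) =
      (1 + eps) ^+ (m ^ 2) * \prod_j b' j * W.
    rewrite /b' !big_split /= prodr_const card_ord -/Q /Y; ring.
  apply: IH => // j.
    have := regular_shrink j vI; rewrite ler_norml => /andP[_].
    have := ler_wpM2l (ltW (P_gt0 (c ord0 (lift ord0 j)))) (Bb (lift ord0 j)).
    rewrite /b'; lra.
  apply: le_trans (hb (lift ord0 j)) _; rewrite exprS mulrA.
  rewrite ler_wpM2r ?exprn_ge0 ?(ltW r_gt0)//.
  rewrite /b' [leLHS]mulrC ler_wpM2r//.
  apply: le_trans (r_le_P (c ord0 (lift ord0 j))) _.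
  by rewrite ler_wpM2r ?(ltW (P_gt0 _))//; lra.
rewrite placementsS natr_sum.
apply: le_trans (ler_sum _ (fun v _ => step v)) _.
rewrite -mulr_sumr big_split /= sumr_const -[_ *+ _]mulr_natl.
have irr : \sum_(v in B ord0) ((v \in irregular c B b)%:R : R) <= b ord0 * Q * eps.
  apply: le_trans (_ : #|irregular c B b|%:R <= _).
    rewrite -sum1_card natr_sum big_mkcond [leRHS]big_mkcond /=.
    by apply: ler_sum => v _; case: (v \in B ord0); case: (v \in irregular _ _ _).
  have ci : #|irregular c B b|%:R <= m%:R * kap := card_irregular c hb1 Bb.
  apply: le_trans ci _; apply: le_trans mk' _.
  rewrite mulrC ler_wpM2r ?(ltW eps_gt0)//; apply: le_trans (hb ord0) _.
  by rewrite ler_wpM2l//; exact: (prod_P_ge c).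
have em0 : 0 <= (1 + eps) ^+ m by apply: exprn_ge0; lra.
apply: le_trans (_ : Y * (b ord0 * Q * (1 + eps) ^+ m.+1) <= _).
  rewrite ler_wpM2l// exprSr.
  have h1 := ler_wpM2r (mulr_ge0 em0 Q0) (Bb ord0).
  have h2 : eps * (b ord0 * Q) <= (1 + eps) ^+ m * eps * (b ord0 * Q).
    rewrite ler_wpM2r ?mulr_ge0// ler_peMl ?(ltW eps_gt0)//; exact: exprn_ege1.
  lra.
rewrite colour_weightS -/Q -/W big_ord_recl.
set Z := \prod_(j < m) _ in Y Y0 step *.
have -> : Y * (b ord0 * Q * (1 + eps) ^+ m.+1) =
    (1 + eps) ^+ (m ^ 2 + m.+1) * (b ord0 * Z * (Q * W)).
  rewrite exprD /Y; ring.
rewrite -[leRHS]mulrA ler_wpM2r//.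
  by rewrite !mulr_ge0// /Z prodr_ge0.
exact/ler_weXn2l/sqrS_ge.
Qed.

(** For the lower bound it suffices to place the first vertex at the candidates
    that are not irregular. *)
Lemma placements_ge m (c : 'I_m -> 'I_m -> bool) (B : 'I_m -> {set V}) (b : 'I_m -> R) :
  m%:R * kap <= eps * h ->
  (forall j, b j <= #|B j|%:R) -> (forall j, h <= b j * r ^+ m) ->
  (1 - eps) ^+ (m ^ 2) * \prod_j b j * colour_weight c <= #|placements c B|%:R.
Proof.
elim: m => [|m IH] in c B b * => mk Bb hb.
  by rewrite placements0 /colour_weight !big_ord0 !mulr1.
have e0 : 0 <= 1 - eps by rewrite subr_ge0 ltW.
have mk' : m%:R * kap <= eps * h.
  by apply: le_trans mk; rewrite ler_wpM2r// ler_nat.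
have hb1 j : h <= b j by exact: le_scaled (hb j).
have b0 j : 0 <= b j by exact: le_trans (hb1 j).
set Q := \prod_(j < m) P (c ord0 (lift ord0 j)).
have Q0 : 0 <= Q by apply: prodr_ge0 => j _; exact: ltW.
set W := colour_weight (shift_colour c).
have W0 : 0 <= W by exact: colour_weight_ge0.
pose I := irregular c B (fun j => #|B j|%:R).
pose Z := \prod_(j < m) b (lift ord0 j).
have Z0 : 0 <= Z by exact: prodr_ge0.
pose Y := (1 - eps) ^+ (m ^ 2 + m) * (Z * (Q * W)).
have Y0 : 0 <= Y by rewrite !mulr_ge0// exprn_ge0.
have step v : v \notin I ->
    Y <= #|placements (shift_colour c) (shrink c B v)|%:R.
  move=> vI; pose b' j := (1 - eps) * P (c ord0 (lift ord0 j)) * b (lift ord0 j).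
  have -> : Y = (1 - eps) ^+ (m ^ 2) * \prod_j b' j * W.
    rewrite /b' !big_split /= prodr_const card_ord -/Q -/Z /Y exprD; ring.
  apply: IH => // j.
    have := regular_shrink j vI; rewrite ler_norml => /andP[+ _].
    have := ler_wpM2l (mulr_ge0 e0 (ltW (P_gt0 (c ord0 (lift ord0 j)))))
      (Bb (lift ord0 j)).
    rewrite /b'; lra.
  apply: le_trans (hb (lift ord0 j)) _; rewrite exprS mulrA.
  rewrite ler_wpM2r ?exprn_ge0 ?(ltW r_gt0)//.
  by rewrite /b' [leLHS]mulrC ler_wpM2r//; exact: r_le_P.
rewrite placementsS natr_sum.
apply: le_trans (_ : \sum_(v in B ord0 :\: I) Y <= _); last first.
  rewrite [leRHS](bigID (fun v => v \notin I)) /=.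
  apply: ler_wpDr; first exact: sumr_ge0.
  rewrite (eq_bigl (fun v => (v \in B ord0) && (v \notin I))); last first.
    by move=> v; rewrite !inE andbC.
  by apply: ler_sum => v /andP[_]; exact: step.
rewrite sumr_const -[_ *+ _]mulr_natl.
have cardI : #|I|%:R <= eps * h.
  apply: le_trans mk'; apply: (card_irregular c) => // j.
  exact: le_trans (Bb j).
have good : (1 - eps) * b ord0 <= #|B ord0 :\: I|%:R.
  have h1 : #|B ord0|%:R <= #|B ord0 :\: I|%:R + #|I|%:R :> R.
    rewrite -natrD ler_nat -(cardsID I (B ord0)) addnC leq_add2l.
    exact/subset_leq_card/subsetIr.
  have h2 := ler_wpM2l (ltW eps_gt0) (hb1 ord0).
  have := Bb ord0; lra.
apply: le_trans (ler_wpM2r Y0 good).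
rewrite colour_weightS -/Q -/W big_ord_recl -/Z.
have -> : (1 - eps) * b ord0 * Y =
    (1 - eps) ^+ (m ^ 2 + m.+1) * (b ord0 * Z * (Q * W)).
  rewrite addnS exprS /Y; ring.
rewrite -[leLHS]mulrA ler_wpM2r ?mulr_ge0//.
apply: ler_wiXn2l => //; last exact: sqrS_ge.
by rewrite gerBl ltW.
Qed.

End Placements.

(** * Labelled induced copies *)

Section Embeddings.

Definition embeddings (n s : nat) (G : graph n) (H : graph s) :
    {set {ffun 'I_s -> 'I_n}} :=
  [set f : {ffun 'I_s -> 'I_n} | injectiveb f &&
    [forall i, forall j, adj G (f i) (f j) == adj H i j]].

Lemma embeddingsP (n s : nat) (G : graph n) (H : graph s) (f : {ffun 'I_s -> 'I_n}) :
  reflect (injective f /\ forall i j, adj G (f i) (f j) = adj H i j)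
    (f \in embeddings G H).
Proof.
rewrite inE; apply: (iffP andP) => -[/injectiveP f_inj fGH]; split=> //.
  by move=> i j; apply/eqP; have /forallP/(_ j) := forallP fGH i.
by apply/forallP => i; apply/forallP => j; apply/eqP.
Qed.

Lemma induces_embedding (n s : nat) (G : graph n) (A : {set 'I_n}) (H : graph s) :
  induces G A H = [exists f in embeddings G H, f @: 'I_s == A].
Proof.
apply: eq_existsb => f; rewrite inE andbA -andbA -andbA.
by congr (_ && _); rewrite andbC.
Qed.

(** The embeddings with a given image differ by an automorphism of [H]. *)
Lemma card_embeddings_image (n s : nat) (G : graph n) (H : graph s)
    (f0 : {ffun 'I_s -> 'I_n}) : f0 \in embeddings G H ->
  #|[set f in embeddings G H | f @: 'I_s == f0 @: 'I_s]| = #|embeddings H H|.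
Proof.
move=> /embeddingsP[f0_inj f0GH].
pose comp (g : {ffun 'I_s -> 'I_s}) : {ffun 'I_s -> 'I_n} := [ffun i => f0 (g i)].
have comp_inj : injective comp.
  move=> g g' /ffunP e; apply/ffunP => i; apply: f0_inj.
  by have := e i; rewrite !ffunE.
rewrite -(card_imset _ comp_inj); apply: eq_card => f; rewrite !inE -/(embeddings G H).
apply/andP/imsetP => [[/andP[f_inj fGH] /eqP im_f]|[g /embeddingsP[g_inj gHH] ->]].
  have /embeddingsP[{}f_inj {}fGH] : f \in embeddings G H by rewrite inE f_inj.
  have im i : f i \in f0 @: 'I_s by rewrite -im_f imset_f.
  have pre i : exists j, f i == f0 j by have /imsetP[j _ ->] := im i; exists j.
  pose g := [ffun i => xchoose (pre i)].
  have f0g i : f0 (g i) = f i by rewrite ffunE; have /eqP <- := xchooseP (pre i).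
  exists g; last by apply/ffunP => i; rewrite ffunE f0g.
  apply/embeddingsP; split=> [i j gij|i j]; last by rewrite -f0GH !f0g fGH.
  by apply: f_inj; rewrite -!f0g gij.
split.
  have : comp g \in embeddings G H; last by rewrite inE.
  apply/embeddingsP; split=> [i j|i j]; rewrite !ffunE; last by rewrite f0GH gHH.
  by move=> /f0_inj/g_inj.
apply/eqP/setP => v; apply/imsetP/imsetP => -[i _ ->].
  by exists (g i); rewrite // ffunE.
have [g' _ gK] := injF_bij g_inj; exists (g' i); rewrite // ffunE.
by rewrite gK.
Qed.

Lemma card_embeddings (n s : nat) (G : graph n) (H : graph s) :
  #|embeddings G H| = (induced_count G H * #|embeddings H H|)%N.
Proof.
rewrite -sum1_card (partition_big (fun f : {ffun 'I_s -> 'I_n} => f @: 'I_s)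
  (fun A => induces G A H)) => [|f fE]; last first.
  by rewrite induces_embedding; apply/existsP; exists f; rewrite fE eqxx.
rewrite /induced_count -sum_nat_const; apply: eq_big => [A|A]; first by rewrite inE.
rewrite induces_embedding => /existsP[f0 /andP[f0E /eqP <-]].
rewrite -(card_embeddings_image f0E) -sum1_card; apply: eq_bigl => f.
by rewrite [in RHS]inE.
Qed.

Lemma embeddings_self_gt0 (s : nat) (H : graph s) : (0 < #|embeddings H H|)%N.
Proof.
apply/card_gt0P; exists [ffun i => i]; apply/embeddingsP.
by split=> [i j|i j]; rewrite !ffunE.
Qed.

Definition colour_nbhd (n : nat) (G : graph n) (c : bool) (v : 'I_n) : {set 'I_n} :=
  [set w | (w != v) && (adj G v w == c)].

(** Adjacency is symmetric, so it suffices to compare each vertex with the ones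
    placed before it. *)
Lemma embeddings_placements (n s : nat) (G : graph n) (H : graph s) :
  embeddings G H = placements (colour_nbhd G) (adj H) (fun _ => [set: 'I_n]).
Proof.
apply/setP => f; rewrite [RHS]inE; apply/embeddingsP/andP => [[f_inj fGH]|[_ fp]].
  split; first by apply/forallP => j; rewrite inE.
  apply/forallP => i; apply/forallP => j; apply/implyP => ij.
  rewrite inE fGH eqxx andbT; apply: contraTneq ij => /f_inj ->.
  by rewrite ltnn.
have lt_ij (i j : 'I_s) : (i < j)%N -> f j != f i /\ adj G (f i) (f j) = adj H i j.
  move=> ij; have /forallP/(_ j)/implyP/(_ ij) := forallP fp i.
  by rewrite inE => /andP[? /eqP].
split=> i j.
  move=> fij; have [/lt_ij[]|/lt_ij[]|/val_inj//] := ltngtP i j.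
    by rewrite fij eqxx.
  by rewrite fij eqxx.
have [/lt_ij[]//|/lt_ij[_]|/val_inj->] := ltngtP i j; last by rewrite !adj_irrefl.
by rewrite adj_sym => ->; rewrite adj_sym.
Qed.

End Embeddings.

(** * The expected number of copies in the Erdos-Renyi graph *)

Section ErdosRenyi.
Variables (R : realType) (p : R).

Definition colour_prob (c : bool) : R := if c then p else 1 - p.

Lemma prod_edges (n : nat) (F : 'I_n * 'I_n -> R) :
  \prod_(e : edge n) F (val e) = \prod_(u : 'I_n * 'I_n | (u.1 < u.2)%N) F u.
Proof.
rewrite [RHS](reindex_omap (val : edge n -> 'I_n * 'I_n) insub); last first.
  by move=> i iA; rewrite insubT.
by apply: eq_bigl => -[i iA] /=; rewrite insubT iA /= eqxx.
Qed.

(** A symmetric weight multiplied over pairs may be multiplied over their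
    images under an injection, although the injection need not preserve the
    order of the two elements of a pair. *)
Lemma prod_pairs_inj (n s : nat) (f : {ffun 'I_s -> 'I_n}) (F : 'I_s -> 'I_s -> R) :
  injective f -> (forall i j, F i j = F j i) ->
  \prod_(w : 'I_s * 'I_s | (f w.1 < f w.2)%N) F w.1 w.2 =
  \prod_(i < s) \prod_(j < s | (i < j)%N) F i j.
Proof.
move=> f_inj F_sym; rewrite (bigID (fun w : 'I_s * 'I_s => (w.1 < w.2)%N)) /=.
have -> : \prod_(w : 'I_s * 'I_s | (f w.1 < f w.2)%N && ~~ (w.1 < w.2)%N) F w.1 w.2 =
    \prod_(w : 'I_s * 'I_s | (w.1 < w.2)%N && ~~ (f w.1 < f w.2)%N) F w.1 w.2.
  rewrite (reindex_inj (inv_inj (@swap_pairK 'I_s 'I_s))).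
  apply: eq_big => [[i j]|[i j] _] /=; last exact: F_sym.
  rewrite -!leqNgt andbC; have [->|ij] := eqVneq i j; first by rewrite !ltnn andbF.
  have neq_le (k : nat) (a b : 'I_k) : a != b -> (a <= b)%N = (a < b)%N.
    by move=> ab; rewrite ltn_neqAle ab.
  by rewrite (neq_le _ _ _ ij) neq_le// (inj_eq f_inj) eq_sym.
under eq_bigl do rewrite andbC.
rewrite -bigID pair_big_dep /=; exact: eq_bigl.
Qed.

(** Being an embedding is a condition on each edge of [x] separately, so the sum
    over [x] factors; edges with an endpoint off the image contribute 1. *)
Lemma erdos_renyi_embedding (n s : nat) (H : graph s) (f : {ffun 'I_s -> 'I_n}) :
  injective f ->
  \sum_(x : graph n) erdos_renyi p x * (f \in embeddings x H)%:R =
  colour_weight colour_prob (adj H).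
Proof.
move=> f_inj.
pose ok (u : 'I_n * 'I_n) (b : bool) :=
  [forall w : 'I_s * 'I_s, ((f w.1, f w.2) == u) ==> (b == adj H w.1 w.2)].
have embE (x : graph n) :
    (f \in embeddings x H) = [forall e : edge n, ok (val e) (x e)].
  apply/embeddingsP/forallP => [[_ fxH] e|ok_f].
    case: e => -[a b] ab; apply/forallP => -[i j] /=.
    apply/implyP => /eqP[ia jb]; rewrite -fxH ia jb /adj (has_edge_lt _ ab).
    rewrite (has_edge_ge _ (ltnW ab)) orbF; apply/eqP; congr (x _).
  have lt_case (i j : 'I_s) : (f i < f j)%N -> adj x (f i) (f j) = adj H i j.
    move=> ij; rewrite /adj (has_edge_lt _ ij) (has_edge_ge _ (ltnW ij)) orbF.
    have /forallP/(_ (i, j)) := ok_f (Sub (f i, f j) ij).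
    by rewrite /= eqxx => /eqP.
  split=> // i j; have [/lt_case//|/lt_case|/val_inj/f_inj->] := ltngtP (f i) (f j).
    by rewrite adj_sym => ->; rewrite adj_sym.
  by rewrite !adj_irrefl.
transitivity (\sum_(x : graph n) \prod_(e : edge n)
    (colour_prob (x e) * (ok (val e) (x e))%:R)).
  apply: eq_bigr => x _; rewrite big_split /= embE; congr (_ * _).
  have [/forallP okx|/forallPn[e ne]] :=
    boolP [forall e : edge n, ok (val e) (x e)].
    by rewrite big1// => e _; rewrite okx.
  by rewrite (bigD1 e)//= (negbTE ne) mul0r.
(* At most one pair [w] is mapped to [u], so [g u] has at most one factor. *)
pose g (u : 'I_n * 'I_n) :=
  \prod_(w : 'I_s * 'I_s | (f w.1, f w.2) == u) colour_prob (adj H w.1 w.2).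
rewrite -(bigA_distr_bigA (fun (e : edge n) b => colour_prob b * (ok (val e) b)%:R)).
have sum_ok u : \sum_b colour_prob b * (ok u b)%:R = g u.
  have [w0 /eqP w0u|no_w] := pickP [pred w | (f w.1, f w.2) == u].
    have only w : ((f w.1, f w.2) == u) = (w == w0).
      apply/eqP/eqP => [|->//]; rewrite -w0u => -[/f_inj e1 /f_inj e2].
      by rewrite [w]surjective_pairing e1 e2 -surjective_pairing.
    rewrite /g (big_pred1 w0)// (bigD1 (adj H w0.1 w0.2))//= big1 => [|b bH].
      rewrite addr0 (_ : ok _ _) ?mulr1//.
      by apply/forallP => w; rewrite only; apply/implyP => /eqP ->.
    rewrite (_ : ok u b = false) ?mulr0//; apply/negP => /forallP/(_ w0).
    by rewrite only eqxx (negbTE bH).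
  have oku b : ok u b by apply/forallP => w; have := no_w w; rewrite /= => ->.
  by rewrite /g [RHS]big_pred0// big_bool !oku /= !mulr1; ring.
under eq_bigr => e _ do rewrite sum_ok.
rewrite prod_edges /g.
transitivity (\prod_(w : 'I_s * 'I_s | (f w.1 < f w.2)%N)
    colour_prob (adj H w.1 w.2)); last first.
  apply: (prod_pairs_inj (F := fun i j => colour_prob (adj H i j))) => // i j.
  by rewrite adj_sym.
rewrite [RHS](partition_big (fun w : 'I_s * 'I_s => (f w.1, f w.2))
  (fun u : 'I_n * 'I_n => (u.1 < u.2)%N))//.
apply: eq_bigr => u lt_u; apply: eq_bigl => w.
by case: eqP lt_u => [<-|]; rewrite ?andbF//= => ->.
Qed.

Lemma expected_embeddings (n s : nat) (H : graph s) :
  \sum_(x : graph n) erdos_renyi p x * #|embeddings x H|%:R =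
  (n ^_ s)%:R * colour_weight colour_prob (adj H).
Proof.
transitivity (\sum_(f : {ffun 'I_s -> 'I_n} | injectiveb f)
   \sum_(x : graph n) erdos_renyi p x * (f \in embeddings x H)%:R).
  rewrite exchange_big /=; apply: eq_bigr => x _.
  rewrite -mulr_sumr; congr (_ * _).
  rewrite -sum1_card natr_sum big_mkcond [RHS]big_mkcond /=.
  apply: eq_bigr => f _; rewrite !inE.
  by case: injectiveb => //=; case: [forall i, _].
rewrite (eq_bigr (fun=> colour_weight colour_prob (adj H))); last first.
  by move=> f /injectiveP; exact: erdos_renyi_embedding.
rewrite sumr_const -[LHS]mulr_natl; congr (_%:R * _).
by have := card_inj_ffuns 'I_s 'I_n; rewrite !card_ord => <-; rewrite cardsE.
Qed.

(** Both sides count labelled copies; passing to induced subgraphs divides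
    numerator and denominator by the same number of automorphisms. *)
Lemma induced_count_ratio (n s : nat) (G : graph n) (H : graph s) :
  (induced_count G H)%:R / er_expected_count p n H =
  #|embeddings G H|%:R / ((n ^_ s)%:R * colour_weight colour_prob (adj H)).
Proof.
have aut0 : #|embeddings H H|%:R != 0 :> R.
  by rewrite pnatr_eq0 -lt0n embeddings_self_gt0.
have -> : (n ^_ s)%:R * colour_weight colour_prob (adj H) =
    er_expected_count p n H * #|embeddings H H|%:R.
  rewrite -expected_embeddings /er_expected_count mulr_suml.
  by apply: eq_bigr => x _; rewrite card_embeddings natrM mulrA.
by rewrite card_embeddings natrM -mulf_div divff// mulr1.
Qed.

End ErdosRenyi.

(** * Codegree-regular graphs are pseudo-random *)

Definition regular (R : realType) (p delta : R) (n : nat) (x : graph n) : Prop :=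
  (forall i, `|degree R x i - p * n%:R| <= delta) /\
  (forall i j, i != j -> `|codegree R x i j - p ^+ 2 * n%:R| <= delta).

Section SecondMoment.
Variables (R : realType) (p delta : R) (n : nat) (x : graph n).
Hypothesis p_gt0 : 0 < p.
Hypothesis p_lt1 : p < 1.
Hypothesis delta_ge0 : 0 <= delta.
Hypothesis x_regular : regular p delta x.

Definition discrepancy (B : {set 'I_n}) (v : 'I_n) : R :=
  \sum_(u in B) (adjr R x u v - p).

(** Expanding the square leaves, for each pair of elements of [B], a quantity
    that the codegree and the degrees determine. *)
Lemma discrepancy_second_moment (B : {set 'I_n}) :
  \sum_v discrepancy B v ^+ 2 <= #|B|%:R * n%:R + 3 * delta * #|B|%:R ^+ 2.
Proof.
have [deg_x codeg_x] := x_regular.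
have -> : \sum_v discrepancy B v ^+ 2 =
    \sum_(u in B) \sum_(w in B) \sum_v (adjr R x u v - p) * (adjr R x w v - p).
  under eq_bigr => v _ do rewrite expr2 /discrepancy mulr_suml.
  rewrite exchange_big /=; apply: eq_bigr => u _.
  by rewrite [RHS]exchange_big /=; apply: eq_bigr => v _; rewrite mulr_sumr.
have pairE u w : \sum_v (adjr R x u v - p) * (adjr R x w v - p) =
    codegree R x u w - p * degree R x u - p * degree R x w + p ^+ 2 * n%:R.
  rewrite /codegree /degree !mulr_sumr -!sumrB.
  have -> : p ^+ 2 * n%:R = \sum_(v < n) p ^+ 2.
    by rewrite sumr_const card_ord mulr_natr.
  by rewrite -big_split; apply: eq_bigr => v _ /=; ring.
have pair_le u w : \sum_v (adjr R x u v - p) * (adjr R x w v - p) <=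
    (u == w)%:R * n%:R + 3 * delta.
  have [->|uw] := eqVneq u w.
    rewrite mul1r; apply: le_trans (_ : n%:R <= _); last by rewrite lerDl mulr_ge0.
    rewrite -[n in leRHS]card_ord -sum1_card natr_sum; apply: ler_sum => v _.
    have /andP[a0 a1] := adjr_bound R x w v.
    have := p_gt0; have := p_lt1; rewrite -expr2 => p1 p0.
    by rewrite -[leLHS]ger0_norm ?sqr_ge0// normrX exprn_ile1// ler_norml; apply/andP; split; lra.
  rewrite mul0r add0r pairE.
  have := codeg_x u w uw; have := deg_x u; have := deg_x w.
  rewrite !ler_norml => /andP[dw _] /andP[du _] /andP[_ cuw].
  have {}dw : p * (p * n%:R - degree R x w) <= delta.
    by apply: le_trans (_ : p * delta <= _);
      [apply: ler_wpM2l; [exact: ltW|lra] | rewrite ler_piMl// ltW].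
  have {}du : p * (p * n%:R - degree R x u) <= delta.
    by apply: le_trans (_ : p * delta <= _);
      [apply: ler_wpM2l; [exact: ltW|lra] | rewrite ler_piMl// ltW].
  lra.
apply: le_trans (_ : \sum_(u in B) \sum_(w in B) ((u == w)%:R * n%:R + 3 * delta) <= _).
  by apply: ler_sum => u _; apply: ler_sum => w _; exact: pair_le.
rewrite le_eqVlt; apply/orP; left; apply/eqP.
transitivity (\sum_(u in B) (n%:R + 3 * delta * #|B|%:R)).
  apply: eq_bigr => u uB; rewrite big_split /= sumr_const mulr_natr.
  rewrite (bigD1 u)//= eqxx mul1r big1 ?addr0// => w /andP[_].
  by rewrite eq_sym => /negbTE->; rewrite mul0r.
by rewrite sumr_const -[LHS]mulr_natl; ring.
Qed.

(** The summand 1 is for [v] itself, which is not among its own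
    non-neighbours. *)
Lemma colour_nbhd_discrepancy c (B : {set 'I_n}) v :
  `| #|colour_nbhd x c v :&: B|%:R - colour_prob p c * #|B|%:R | <=
  `|discrepancy B v| + 1.
Proof.
have cardE' (A : {set 'I_n}) : #|A :&: B|%:R = \sum_(u in B) (u \in A)%:R :> R.
  rewrite -sum1_card natr_sum big_mkcond [RHS]big_mkcond /=.
  by apply: eq_bigr => u _; rewrite inE andbC; case: (u \in B); case: (u \in A).
have cB : colour_prob p c * #|B|%:R = \sum_(u in B) colour_prob p c.
  by rewrite sumr_const mulr_natr.
rewrite cardE' cB -sumrB; case: c {cB}; rewrite /colour_prob.
  rewrite (eq_bigr (fun u => adjr R x u v - p)); first by rewrite lerDl.
  move=> u _; rewrite inE eqb_id adj_sym.
  by case: eqVneq => [->|_] //; rewrite adjr_irrefl adj_irrefl.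
have -> : \sum_(u in B) ((u \in colour_nbhd x false v)%:R - (1 - p)) =
    - discrepancy B v - \sum_(u in B) ((u == v)%:R : R).
  rewrite /discrepancy -sumrN -sumrB; apply: eq_bigr => u _.
  rewrite inE eqbF_neg adj_sym /adjr.
  by case: eqVneq => [->|_]; rewrite ?adj_irrefl /=; [|case: adj => /=]; ring.
apply: le_trans (ler_normB _ _) _; rewrite normrN lerD2l.
rewrite ger0_norm ?sumr_ge0// -natr_sum -big_mkcondr sum1_card lern1.
apply: leq_trans (_ : #|pred1 v| <= _)%N; last by rewrite card1.
by apply/subset_leq_card/fintype.subsetP => u; rewrite !inE => /andP[].
Qed.

Variables (q eps h : R).
Hypothesis q_gt0 : 0 < q.
Hypothesis q_le : forall c, q <= colour_prob p c.
Hypothesis eps_gt0 : 0 < eps.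
Hypothesis h_gt0 : 0 < h.
Hypothesis eps_h : 2 <= eps * q * h.

(** The bound on the number of exceptional vertices that Chebyshev's inequality
    gives for sets of size at least [h]. *)
Definition irregular_bound : R := 4 * (n%:R / h + 3 * delta) / (eps * q) ^+ 2.

Lemma irregular_bound_ge0 : 0 <= irregular_bound.
Proof.
rewrite divr_ge0 ?sqr_ge0// mulr_ge0// addr_ge0 ?mulr_ge0//.
by rewrite invr_ge0 ltW.
Qed.

Lemma few_irregular_vertices c (B : {set 'I_n}) (b : R) :
  h <= b -> #|B|%:R <= b ->
  #|[set v | eps * colour_prob p c * b <
    `| #|colour_nbhd x c v :&: B|%:R - colour_prob p c * #|B|%:R | ]|%:R <=
  irregular_bound.
Proof.
move=> hb Bb; set I := [set v | _].
have b0 : 0 < b by exact: lt_le_trans hb.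
have eq0 : 0 < eps * q by rewrite mulr_gt0.
pose tau := eps * q * b / 2.
have tau0 : 0 < tau by rewrite divr_gt0// mulr_gt0.
have I_big v : v \in I -> tau ^+ 2 <= discrepancy B v ^+ 2.
  rewrite inE => vI; have := lt_le_trans vI (colour_nbhd_discrepancy c B v) => d.
  have h1 : eps * q * b <= eps * colour_prob p c * b.
    by rewrite ler_wpM2r ?(ltW b0)// ler_wpM2l ?(ltW eps_gt0)// q_le.
  have h2 : eps * q * h <= eps * q * b by rewrite ler_wpM2l// ltW.
  have eh := eps_h.
  have h3 : tau <= `|discrepancy B v| by rewrite /tau; lra.
  by rewrite -[leRHS]ger0_norm ?sqr_ge0// normrX lerXn2r// nnegrE// ltW.
have := discrepancy_second_moment B => m2.
have {}m2 : #|I|%:R * tau ^+ 2 <= b * n%:R + 3 * delta * b ^+ 2.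
  apply: le_trans (_ : \sum_(v in I) discrepancy B v ^+ 2 <= _).
    rewrite mulr_natl -sumr_const.
    exact: ler_sum.
  apply: le_trans (_ : \sum_v discrepancy B v ^+ 2 <= _).
    rewrite [leRHS](bigID (fun v => v \in I)) /= lerDl.
    by apply: sumr_ge0 => v _; exact: sqr_ge0.
  apply: le_trans m2 _; apply: lerD; first by rewrite ler_wpM2r.
  by rewrite ler_wpM2l ?mulr_ge0// lerXn2r// nnegrE// ltW.
rewrite /irregular_bound ler_pdivlMr ?exprn_gt0//.
have e : #|I|%:R * (eps * q) ^+ 2 = 4 * (#|I|%:R * tau ^+ 2) / b ^+ 2.
  by rewrite /tau; field; rewrite gt_eqF.
rewrite e ler_pdivrMr ?exprn_gt0// -mulrA ler_wpM2l//.
apply: le_trans m2 _; rewrite [leRHS]mulrDl lerD2r expr2 mulrA.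
have -> : n%:R / h * b * b = b * n%:R * (b / h) by ring.
by rewrite ler_peMr ?mulr_ge0 ?(ltW b0)// ler_pdivlMr// mul1r.
Qed.

End SecondMoment.

Local Open Scope classical_set_scope.

(** * Typical graphs *)

Section Typical.
Variables (R : realType) (beta gamma : R).
Hypothesis gamma_ge0 : 0 <= gamma.

Lemma near_ln_ge (A : R) : \forall n \near \oo, A <= ln (n%:R : R).
Proof.
near=> n; have nA : expR A <= n%:R by near: n; exact: nbhs_infty_ger.
by rewrite -[A]expRK ler_ln ?posrE ?expR_gt0// (lt_le_trans (expR_gt0 A)).
Unshelve. all: by end_near. Qed.

(** The factor [ln n] above the standard deviation pays for the union over all
    pairs of vertices. *)
Definition typical (n : nat) (x : graph n) : bool :=
  let t := Num.sqrt n%:R * ln n%:R in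
  [forall i, `|residual beta gamma (fun _ _ => 1) i x| <= t] &&
  [forall i, forall j, (i != j) ==>
     (`|residual beta gamma (fun k y => adjr R y j k) i x| <= t)].

Lemma atypical_le_sum (n m : nat) : (1 < n)%N ->
  \sum_(x : graph n | ~~ typical x) ergm beta gamma x <=
  (n%:R + n%:R * n%:R) *
  (m.*2%:R * residual_const beta gamma / ln n%:R ^+ 2) ^+ m.
Proof.
move=> n1; pose t : R := Num.sqrt n%:R * ln n%:R.
have n0 : 0 < n%:R :> R by rewrite ltr0n ltnW.
have t0 : 0 < t by rewrite mulr_gt0 ?sqrtr_gt0// ln_gt0// ltr1n.
have ergm_ge0 (x : graph n) : 0 <= ergm beta gamma x.
  by rewrite divr_ge0 ?expR_ge0// sumr_ge0// => y _; exact: expR_ge0.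
have -> : m.*2%:R * residual_const beta gamma / ln n%:R ^+ 2 =
    n%:R * (m.*2%:R * residual_const beta gamma) / t ^+ 2.
  have l0 : ln (n%:R : R) != 0 by rewrite gt_eqF// ln_gt0// ltr1n.
  by rewrite /t exprMn sqr_sqrtr ?ltW//; field; rewrite l0 gt_eqF.
set B := (X in _ * X).
have one i g : (forall k x, 0 <= g k x <= 1) ->
    (forall k l x, k != i -> l != i -> g l (toggle i k x) = g l x) ->
    \sum_(x : graph n | t < `|residual beta gamma g i x|) ergm beta gamma x <= B.
  by move=> g_bound g_toggle; exact: residual_tail.
have one1 i : \sum_(x : graph n | t < `|residual beta gamma (fun _ _ => 1) i x|)
    ergm beta gamma x <= B.
  by apply: one => // k x; rewrite ler01 lexx.
have one2 i j : i != j ->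
    \sum_(x : graph n | t < `|residual beta gamma (fun k y => adjr R y j k) i x|)
    ergm beta gamma x <= B.
  move=> ij; apply: one => [k x|k l x ki li]; first exact: adjr_bound.
  rewrite /adjr adj_toggle 1?eq_sym//.
  rewrite (_ : same_pair i k j l = false) ?addbF//.
  by rewrite /same_pair (negbTE li) andbF orbF eq_sym (negbTE ij).
have B0 : 0 <= B.
  apply: le_trans (one1 (Ordinal (ltnW n1))).
  by apply: sumr_ge0.
pose bad1 (i : 'I_n) (x : graph n) := t < `|residual beta gamma (fun _ _ => 1) i x|.
pose bad2 (i j : 'I_n) (x : graph n) := (i != j) &&
  (t < `|residual beta gamma (fun k y => adjr R y j k) i x|).
apply: le_trans (_ : \sum_(x : graph n)
    (\sum_(i < n) ergm beta gamma x * (bad1 i x)%:R +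
     \sum_(i < n) \sum_(j < n) ergm beta gamma x * (bad2 i j x)%:R) <= _).
  rewrite big_mkcond; apply: ler_sum => x _.
  have s1 : 0 <= \sum_(i < n) ergm beta gamma x * (bad1 i x)%:R.
    by apply: sumr_ge0 => i _; rewrite mulr_ge0.
  have s2 : 0 <= \sum_(i < n) \sum_(j < n) ergm beta gamma x * (bad2 i j x)%:R.
    by apply: sumr_ge0 => i _; apply: sumr_ge0 => j _; rewrite mulr_ge0.
  case: ifP => [|_]; last by rewrite addr_ge0.
  rewrite negb_and => /orP[/forallPn[i]|/forallPn[i /forallPn[j]]].
    rewrite -ltNge => h; apply: ler_wpDr => //.
    rewrite (bigD1 i)//= {1}/bad1 h mulr1 lerDl.
    by apply: sumr_ge0 => k _; rewrite mulr_ge0.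
  rewrite negb_imply -ltNge => h; apply: ler_wpDl => //.
  rewrite (bigD1 i)//= (bigD1 j)//= {1}/bad2 h mulr1 -addrA lerDl.
  rewrite addr_ge0//; first by apply: sumr_ge0 => k _; rewrite mulr_ge0.
  by apply: sumr_ge0 => k _; apply: sumr_ge0 => l _; rewrite mulr_ge0.
have condE (b : pred (graph n)) : \sum_x ergm beta gamma x * (b x)%:R =
    \sum_(x | b x) ergm beta gamma x.
  rewrite [RHS]big_mkcond; apply: eq_bigr => x _.
  by case: ifP; rewrite ?mulr1 ?mulr0.
rewrite big_split mulrDl /=; apply: lerD.
  rewrite exchange_big /=; apply: le_trans (_ : \sum_(i < n) B <= _).
    by apply: ler_sum => i _; rewrite (condE (bad1 i)); exact: one1.
  by rewrite sumr_const card_ord mulr_natl.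
rewrite exchange_big /=; apply: le_trans (_ : \sum_(i < n) n%:R * B <= _); last first.
  by rewrite sumr_const card_ord -mulrA [in leRHS]mulr_natl.
apply: ler_sum => i _; rewrite exchange_big /=.
apply: le_trans (_ : \sum_(j < n) B <= _); last first.
  by rewrite sumr_const card_ord mulr_natl.
apply: ler_sum => j _; rewrite (condE (bad2 i j)) /bad2.
have [->|ij] := eqVneq i j; last exact: one2.
by rewrite big_pred0.
Qed.

Lemma poly_le_pow5 (y : R) : 3 <= y ->
  (y + y * y) * (y * (y + 1)) <= y ^+ 5.
Proof.
move=> y3; have -> : (y + y * y) * (y * (y + 1)) = y ^+ 2 * (y + 1) ^+ 2 by ring.
rewrite (_ : y ^+ 5 = y ^+ 2 * y ^+ 3); last by ring.
rewrite ler_wpM2l ?sqr_ge0//.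
have h : 0 <= (y - 3) * (y ^+ 2 + 2 * y) by apply: mulr_ge0; nra.
lra.
Qed.

(** The exponent [m] of order [ln n] makes the bound smaller than any fixed
    power of [n], although each moment bound grows like [m ^ m]. *)
Lemma atypical_prob : \forall n \near \oo,
  \sum_(x : graph n | ~~ typical x) ergm beta gamma x <=
  n%:R^-1 - n.+1%:R^-1.
Proof.
set D := residual_const beta gamma.
near=> n.
have n3 : (3 <= n)%N by near: n; exact: nbhs_infty_ge.
have l1 : 1 <= ln (n%:R : R) by near: n; exact: near_ln_ge.
have lD : 4 * D * expR 5 <= ln (n%:R : R) by near: n; exact: near_ln_ge.
set l := ln n%:R in l1 lD.
have l0 : 0 < l by lra.
have n0 : 0 < n%:R :> R by rewrite ltr0n (leq_trans _ n3).
have lE : expR l = n%:R by rewrite lnK.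
have D0 : 0 <= D.
  by rewrite /D /residual_const mulr_ge0 ?addr_ge0 ?mulr_ge0 ?expR_ge0.
pose m := (Num.truncn l).+1.
have lm : l <= m%:R by apply/ltW/truncnS_gt.
have ml : m%:R <= 2 * l.
  have h : (Num.truncn l)%:R <= l by rewrite truncn_le// ltW.
  have -> : m%:R = (Num.truncn l)%:R + 1 :> R by rewrite natr1.
  lra.
apply: le_trans (atypical_le_sum m _) _; first exact: leq_trans n3.
have base : m.*2%:R * D / l ^+ 2 <= expR (- 5).
  rewrite expRN ler_pdivrMr ?exprn_gt0// [leRHS]mulrC ler_pdivlMr ?expR_gt0//.
  have -> : m.*2%:R = 2 * m%:R :> R by rewrite -muln2 natrM mulrC.
  apply: le_trans (_ : 4 * D * expR 5 * l <= _).
    have : 0 <= (2 * l - m%:R) * (D * expR 5) by rewrite mulr_ge0 ?subr_ge0// mulr_ge0 ?expR_ge0.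
    lra.
  by rewrite expr2 ler_wpM2r// ltW.
have pow : (m.*2%:R * D / l ^+ 2) ^+ m <= (n%:R ^+ 5)^-1.
  apply: le_trans (_ : expR (- 5) ^+ m <= _).
    rewrite lerXn2r ?nnegrE ?expR_ge0//.
    by rewrite divr_ge0 ?sqr_ge0// mulr_ge0.
  rewrite -expRM_natl -lE -expRM_natl -expRN ler_expR; lra.
apply: le_trans (ler_wpM2l _ pow) _; first by rewrite addr_ge0// mulr_ge0.
have n10 : 0 < n%:R + 1 :> R by rewrite addr_gt0.
have -> : n%:R^-1 - n.+1%:R^-1 = (n%:R * (n%:R + 1))^-1 :> R.
  have -> : n.+1%:R = n%:R + 1 :> R by rewrite natr1.
  by field; rewrite !gt_eqF//; apply/andP.
rewrite ler_pdivrMr ?exprn_gt0// [leRHS]mulrC ler_pdivlMr ?mulr_gt0//.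
have n3' : 3 <= n%:R :> R by rewrite ler_nat.
exact: poly_le_pow5.
Unshelve. all: by end_near. Qed.

End Typical.

(** * The mean-field map *)

Section MeanField.
Variables (R : realType) (beta gamma : R).

Lemma mean_field_derivable (q : R) : derivable (mean_field beta gamma) q 1.
Proof.
pose h : R -> R := cst beta + cst gamma * (id ^+ 2).
have dh : derivable h q 1.
  apply: derivableD; first exact: derivable_cst.
  apply: derivableM; first exact: derivable_cst.
  exact/derivableX/derivable_id.
have de : derivable (expR \o h) q 1.
  apply/derivable1_diffP/differentiable_comp; apply/derivable1_diffP.
    exact: dh.
  exact: derivable_expR.
have -> : mean_field beta gamma =
    (expR \o h) * (fun x => ((cst 1 + (expR \o h)) x)^-1).
  by apply/funext => x; rewrite /mean_field /h !fctE.
apply: derivableM; first exact: de.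
apply: derivableV; first by rewrite !fctE gt_eqF// addr_gt0 ?expR_gt0.
apply: derivableD; [exact: derivable_cst|exact: de].
Qed.

Lemma mean_field_continuous (a b : R) :
  {within `[a, b], continuous (fun q => q - mean_field beta gamma q)}.
Proof.
apply: derivable_within_continuous => q _.
apply: derivableB; first exact: derivable_id.
exact: mean_field_derivable.
Qed.

Hypothesis gamma_gt0 : 0 < gamma.

Lemma mean_field_gt0 q : 0 < mean_field beta gamma q.
Proof. exact: sigmoid_gt0. Qed.

Lemma mean_field_lt1 q : mean_field beta gamma q < 1.
Proof. exact: sigmoid_lt1. Qed.

Lemma mean_field_mono (q r : R) : 0 <= q -> q <= r ->
  mean_field beta gamma q <= mean_field beta gamma r.
Proof.
move=> q0 qr; apply: sigmoid_mono.
by rewrite lerD2l ler_pM2l// lerXn2r ?nnegrE// (le_trans q0).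
Qed.

Variable p : R.
Hypothesis p_gt0 : 0 < p.
Hypothesis p_lt1 : p < 1.
Hypothesis p_fixed : mean_field beta gamma p = p.
Hypothesis p_unique : forall q : R, 0 < q -> q < 1 ->
  mean_field beta gamma q = q -> q = p.
Hypothesis p_stable : derive1 (mean_field beta gamma) p < 1.

Local Notation psi := (mean_field beta gamma).

(** Since [psi 1 < 1], a failure at [q] would produce a second fixed point
    between [q] and 1. *)
Lemma mean_field_lt_id q : p < q -> q <= 1 -> 0 < q - psi q.
Proof.
move=> pq q1; rewrite ltNge; apply/negP => Dq.
have D1 : 0 < 1 - psi 1 by rewrite subr_gt0 mean_field_lt1.
have [c cq Dc] : exists2 c, c \in `[q, 1]%R & c - psi c = 0.
  apply: (@IVT R (fun q => q - psi q)) => //; first exact: mean_field_continuous.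
  by rewrite ge_min le_max Dq (ltW D1) orbT.
move: cq; rewrite in_itv /= => /andP[qc]; rewrite le_eqVlt => /orP[/eqP c1|c1].
  by rewrite c1 in Dc; rewrite Dc ltxx in D1.
have cp : c = p.
  apply: p_unique => //; first exact: lt_trans (lt_le_trans pq qc).
  by apply/eqP; rewrite eq_sym -subr_eq0 Dc.
by rewrite cp leNgt pq in qc.
Qed.

Lemma mean_field_gt_id q : 0 <= q -> q < p -> q - psi q < 0.
Proof.
move=> q0 qp; rewrite ltNge; apply/negP => Dq.
have D0 : 0 - psi 0 < 0 by rewrite sub0r oppr_lt0 mean_field_gt0.
have [c cq Dc] : exists2 c, c \in `[0, q]%R & c - psi c = 0.
  apply: (@IVT R (fun q => q - psi q)) => //; first exact: mean_field_continuous.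
  by rewrite ge_min le_max Dq (ltW D0) orbT.
move: cq; rewrite in_itv /= => /andP[]; rewrite le_eqVlt => /orP[/eqP c0 _|c0 cq].
  by rewrite -c0 in Dc; rewrite Dc ltxx in D0.
have cp : c = p.
  apply: p_unique => //; first exact: le_lt_trans (lt_trans qp p_lt1).
  by apply/eqP; rewrite eq_sym -subr_eq0 Dc.
by rewrite cp leNgt qp in cq.
Qed.

(** Near [p] the gap comes from the derivative, and away from [p] from
    compactness, since [p] is the only fixed point. *)
Lemma mean_field_gap : exists2 kappa : R, 0 < kappa &
  (forall q, p <= q -> q <= 1 -> kappa * (q - p) <= q - psi q) /\
  (forall q, 0 <= q -> q <= p -> kappa * (p - q) <= psi q - q).
Proof.
have := p_stable; set d := derive1 psi p => d_lt1.
pose k1 := (1 - d) / 2.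
have k10 : 0 < k1 by rewrite divr_gt0// subr_gt0.
have : (fun h => h^-1 *: (psi (h + p) - psi p)) @ 0^' --> d.
  have := @mean_field_derivable p.
  rewrite /d derive1E /derivable /derive => /= cv.
  have e : (fun h => h^-1 *: (psi (h + p) - psi p)) =
    (fun h => h^-1 *: ((psi \o shift p) (h *: 1) - psi p)).
    by apply/funext => h /=; rewrite [h%:A]mulr1.
  by rewrite e.
move=> /cvgr_lt /(_ (1 - k1)); rewrite p_fixed.
have d1 : d < 1 - k1 by rewrite /k1; lra.
move=> /(_ d1); rewrite near_withinE => -[r /= r0 near_p].
have nearP q : `|q - p| < r -> q != p -> (q - p)^-1 * (psi q - p) < 1 - k1.
  move=> qr qp; have := near_p (q - p); rewrite /= sub0r normrN => /(_ qr).
  by rewrite subr_eq0 subrK; apply.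
pose a := Num.min (p + r / 2) 1; pose b := Num.max (p - r / 2) 0.
have r20 : 0 < r / 2 by rewrite divr_gt0.
have pa : p < a by rewrite lt_min ltrDl r20 p_lt1.
have bp : b < p by rewrite gt_max p_gt0 andbT gtrBl.
have a1 : a <= 1 by rewrite ge_min lexx orbT.
have b0 : 0 <= b by rewrite le_max lexx orbT.
have [ca] := @EVT_min R (fun q => q - psi q) a 1 a1 (@mean_field_continuous a 1).
rewrite in_itv /= => /andP[aca ca1] min_a.
have [cb] := @EVT_max R (fun q => q - psi q) 0 b b0 (@mean_field_continuous 0 b).
rewrite in_itv /= => /andP[cb0 cbb] max_b.
pose k2 := ca - psi ca; pose k3 := psi cb - cb.
have k20 : 0 < k2 by apply: mean_field_lt_id => //; exact: lt_le_trans aca.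
have k30 : 0 < k3.
  by rewrite -oppr_lt0 opprB mean_field_gt_id//; exact: le_lt_trans bp.
exists (Num.min k1 (Num.min k2 k3)); first by rewrite !lt_min k10 k20.
set k := Num.min _ _.
have kk1 : k <= k1 by rewrite ge_min lexx.
have kk2 : k <= k2 by rewrite !ge_min lexx orbT.
have kk3 : k <= k3 by rewrite !ge_min lexx !orbT.
split=> q.
- move=> pq q1; have [->|qp] := eqVneq q p; first by rewrite p_fixed subrr mulr0.
  have qp0 : 0 < q - p by rewrite subr_gt0 lt_neqAle eq_sym qp.
  have [qr|qr] := ltP q (p + r / 2).
    have := nearP q; rewrite gtr0_norm// => /(_ _ qp).
    rewrite mulrC ltr_pdivrMr// => h.
    have {}h : psi q - p < (1 - k1) * (q - p) by apply: h; lra.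
    have : 0 <= (k1 - k) * (q - p) by rewrite mulr_ge0 ?subr_ge0.
    lra.
  apply: le_trans (_ : k2 <= _).
    have h2 : 0 <= k2 * (1 - (q - p)) by apply: mulr_ge0; lra.
    have : 0 <= (k2 - k) * (q - p) by rewrite mulr_ge0 ?subr_ge0.
    lra.
  by apply: min_a; rewrite in_itv /= q1 andbT ge_min qr.
- move=> q0 pq; have [->|qp] := eqVneq q p; first by rewrite p_fixed subrr mulr0.
  have qp0 : 0 < p - q by rewrite subr_gt0 lt_neqAle qp.
  have [qr|qr] := ltP (p - r / 2) q.
    have := nearP q; rewrite distrC gtr0_norm// => /(_ _ qp).
    rewrite -[q - p]opprB invrN mulNr -mulrN opprB mulrC ltr_pdivrMr// => h.
    have {}h : p - psi q < (1 - k1) * (p - q) by apply: h; lra.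
    have : 0 <= (k1 - k) * (p - q) by rewrite mulr_ge0 ?subr_ge0.
    lra.
  apply: le_trans (_ : k3 <= _).
    have h2 : 0 <= k3 * (1 - (p - q)) by apply: mulr_ge0; lra.
    have : 0 <= (k3 - k) * (p - q) by rewrite mulr_ge0 ?subr_ge0.
    lra.
  rewrite -[leRHS]opprB -[k3]opprB lerN2; apply: max_b.
  by rewrite in_itv /= q0 /= le_max qr.
Qed.

(** The maximal and the minimal codegree density satisfy, respectively, the two
    premises. With [M = q ^ 2] they bound [(q - psi q) * (q + psi q)] on one
    side, and the gap turns this into a distance to [p] of the same order. *)
Lemma mean_field_sandwich : exists2 K : R, 0 < K & forall M eta : R,
  0 <= M -> M <= 1 -> 0 <= eta ->
  let phi := sigmoid (beta + gamma * M) in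
  (M <= phi ^+ 2 + eta -> M <= p ^+ 2 + K * eta) /\
  (phi ^+ 2 - eta <= M -> p ^+ 2 - K * eta <= M).
Proof.
have [kappa k0 [above below]] := mean_field_gap.
pose c := Num.min p (psi 0).
have c0 : 0 < c by rewrite lt_min p_gt0 mean_field_gt0.
exists (2 / (kappa * c)); first by rewrite divr_gt0 ?mulr_gt0.
move=> M eta M0 M1 eta0 phi.
have kc0 : 0 < kappa * c by rewrite mulr_gt0.
pose q := Num.sqrt M.
have q0 : 0 <= q by exact: sqrtr_ge0.
have qM : q ^+ 2 = M by rewrite sqr_sqrtr.
have q1 : q <= 1 by rewrite -sqrtr1 ler_wsqrtr.
have phiE : phi = psi q by rewrite /phi -qM.
have K0 : 0 <= 2 / (kappa * c) * eta.
  by rewrite mulr_ge0// divr_ge0// ltW.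
rewrite phiE -qM mulrAC; split=> h.
- have [qp|/ltW pq] := leP q p.
    apply: le_trans (_ : p ^+ 2 <= _); first by rewrite lerXn2r ?nnegrE// ltW.
    by rewrite lerDl mulrAC.
  have {above} ab := above q pq q1.
  rewrite -lerBlDl ler_pdivlMr//.
  have cp : c <= p by rewrite ge_min lexx.
  have psi0 := mean_field_gt0 q.
  have e1 : kappa * (q - p) * c <= eta.
    apply: le_trans (_ : (q - psi q) * (q + psi q) <= _); last first.
      by rewrite -subr_sqr lerBlDl.
    apply: ler_pM => //; first by rewrite mulr_ge0 ?subr_ge0// ltW.
      exact: ltW.
    lra.
  have e2 : q ^+ 2 - p ^+ 2 <= 2 * (q - p).
    by rewrite subr_sqr mulrC ler_wpM2r ?subr_ge0//; have := p_lt1; lra.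
  have := ler_wpM2r (ltW kc0) e2; lra.
- have [pq|/ltW qp] := leP p q.
    apply: le_trans (_ : p ^+ 2 <= _); last by rewrite lerXn2r ?nnegrE// ltW.
    by rewrite gerBl mulrAC.
  have {below} be := below q q0 qp.
  rewrite lerBlDl -lerBlDr ler_pdivlMr//.
  have cp : c <= psi q.
    by rewrite ge_min; apply/orP; right; exact: mean_field_mono.
  have e1 : kappa * (p - q) * c <= eta.
    apply: le_trans (_ : (psi q - q) * (psi q + q) <= _); last first.
      by rewrite -subr_sqr lerBlDl -lerBlDr.
    apply: ler_pM => //; first by rewrite mulr_ge0 ?subr_ge0// ltW.
      exact: ltW.
    lra.
  have e2 : p ^+ 2 - q ^+ 2 <= 2 * (p - q).
    by rewrite subr_sqr mulrC ler_wpM2r ?subr_ge0//; have := p_lt1; lra.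
  have := ler_wpM2r (ltW kc0) e2; lra.
Qed.

End MeanField.

(** * Typical graphs are codegree-regular *)

Section TypicalRegular.
Variables (R : realType) (beta gamma : R).
Hypothesis gamma_gt0 : 0 < gamma.

Section OneGraph.
Variables (n : nat) (x : graph n) (t : R).
Hypothesis n_gt1 : (1 < n)%N.
Hypothesis t_ge1 : 1 <= t.
Hypothesis residual1 : forall i,
  `|residual beta gamma (fun _ _ => 1) i x| <= t.
Hypothesis residual2 : forall i j, i != j ->
  `|residual beta gamma (fun k y => adjr R y j k) i x| <= t.

Let pi_ i k := edge_prob beta gamma x i k.

Lemma degree_residual i :
  `|degree R x i - \sum_(k | k != i) pi_ i k| <= t.
Proof.
have := residual1 i; rewrite /residual.
under eq_bigr => k _ do rewrite mulr1.
by rewrite sumrB => h; rewrite /degree (bigD1 i)//= adjr_irrefl add0r.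
Qed.

Lemma codegree_residual i j : i != j ->
  `|codegree R x i j - \sum_(k | k != i) pi_ i k * adjr R x j k| <= t.
Proof.
move=> /residual2; rewrite /residual.
under eq_bigr => k _ do rewrite mulrBl.
by rewrite sumrB => h; rewrite /codegree (bigD1 i)//= adjr_irrefl mul0r add0r.
Qed.

Let n_gt0 : 0 < n%:R :> R. Proof. by rewrite ltr0n ltnW. Qed.

Lemma sum_neq_const (i : 'I_n) (c : R) : \sum_(k | k != i) c = (n%:R - 1) * c.
Proof.
have : \sum_(k < n) c = c + \sum_(k | k != i) c by rewrite (bigD1 i).
rewrite sumr_const card_ord -[in LHS]mulr_natl; lra.
Qed.

Lemma degree_le (M : R) i :
  (forall k, k != i -> codegree R x i k <= M * n%:R) ->
  degree R x i <= sigmoid (beta + gamma * M) * n%:R + t.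
Proof.
move=> codegM; have := degree_residual i; rewrite ler_norml => /andP[_ h].
have : \sum_(k | k != i) pi_ i k <= \sum_(k | k != i) sigmoid (beta + gamma * M).
  apply: ler_sum => k ki; apply: sigmoid_mono; rewrite lerD2l.
  by rewrite -mulrA ler_pM2l// mulrC ler_pdivrMr// codegM.
rewrite sum_neq_const; have := sigmoid_gt0 (beta + gamma * M); lra.
Qed.

Lemma degree_ge (m : R) i :
  (forall k, k != i -> m * n%:R <= codegree R x i k) ->
  sigmoid (beta + gamma * m) * n%:R - t - 1 <= degree R x i.
Proof.
move=> codegm; have := degree_residual i; rewrite ler_norml => /andP[h _].
have : \sum_(k | k != i) sigmoid (beta + gamma * m) <= \sum_(k | k != i) pi_ i k.
  apply: ler_sum => k ki; apply: sigmoid_mono; rewrite lerD2l.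
  by rewrite -mulrA ler_pM2l// mulrC ler_pdivlMr// codegm.
rewrite sum_neq_const; have := sigmoid_lt1 (beta + gamma * m); lra.
Qed.

(** By monotonicity of the sigmoid, [M] bounds every conditional probability
    that occurs. The codegree is replaced in two steps, first by a multiple of
    the degree of [b], then by the conditional mean of that degree. *)
Lemma codegree_max_le (M : R) a b : a != b ->
  (forall i j, i != j -> codegree R x i j <= M * n%:R) ->
  codegree R x a b <= (sigmoid (beta + gamma * M)) ^+ 2 * n%:R + 2 * t.
Proof.
move=> ab codegM; have := codegree_residual ab.
rewrite ler_norml => /andP[_ h].
set Phi := sigmoid _.
have Phi0 : 0 < Phi by exact: sigmoid_gt0.
have Phi1 : Phi < 1 by exact: sigmoid_lt1.
have h1 : \sum_(k | k != a) pi_ a k * adjr R x b k <= Phi * degree R x b.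
  rewrite /degree mulr_sumr [leRHS](bigID (fun k => k != a)) /=.
  apply: ler_wpDr.
    apply: sumr_ge0 => k _; apply: mulr_ge0; first exact: ltW.
    by have /andP[] := adjr_bound R x b k.
  apply: ler_sum => k ka; apply: ler_wpM2r.
    by have /andP[] := adjr_bound R x b k.
  apply: sigmoid_mono; rewrite lerD2l.
  by rewrite -mulrA ler_pM2l// mulrC ler_pdivrMr// codegM// eq_sym.
have h2 : degree R x b <= Phi * n%:R + t.
  by apply: degree_le => k kb; apply: codegM; rewrite eq_sym.
have h3 := ler_wpM2l (ltW Phi0) h2.
have h4 : Phi * t <= t by rewrite ler_piMl; have := t_ge1; lra.
have -> : Phi ^+ 2 * n%:R = Phi * (Phi * n%:R) by ring.
lra.
Qed.

Lemma codegree_min_ge (m : R) a b : a != b ->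
  (forall i j, i != j -> m * n%:R <= codegree R x i j) ->
  (sigmoid (beta + gamma * m)) ^+ 2 * n%:R - 4 * t <= codegree R x a b.
Proof.
move=> ab codegm; have := codegree_residual ab.
rewrite ler_norml => /andP[h _].
set phi := sigmoid _.
have phi0 : 0 < phi by exact: sigmoid_gt0.
have phi1 : phi < 1 by exact: sigmoid_lt1.
have h1 : phi * degree R x b - 1 <= \sum_(k | k != a) pi_ a k * adjr R x b k.
  rewrite /degree mulr_sumr (bigD1 a)//=.
  have : \sum_(i | i != a) phi * adjr R x b i <=
      \sum_(k | k != a) pi_ a k * adjr R x b k.
    apply: ler_sum => k ka; apply: ler_wpM2r.
      by have /andP[] := adjr_bound R x b k.
    apply: sigmoid_mono; rewrite lerD2l.
    by rewrite -mulrA ler_pM2l// mulrC ler_pdivlMr// codegm// eq_sym.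
  have /andP[a0 a1] := adjr_bound R x b a.
  have : phi * adjr R x b a <= 1 by apply: mulr_ile1 => //; exact: ltW.
  lra.
have h2 : phi * n%:R - t - 1 <= degree R x b.
  by apply: degree_ge => k kb; apply: codegm; rewrite eq_sym.
have h3 := ler_wpM2l (ltW phi0) h2.
have h4 : phi * t <= t by rewrite ler_piMl; have := t_ge1; lra.
have -> : phi ^+ 2 * n%:R = phi * (phi * n%:R) by ring.
have := t_ge1; lra.
Qed.

End OneGraph.

Variable p : R.
Hypothesis p_gt0 : 0 < p.
Hypothesis p_lt1 : p < 1.
Hypothesis p_fixed : mean_field beta gamma p = p.
Hypothesis p_unique : forall q : R, 0 < q -> q < 1 ->
  mean_field beta gamma q = q -> q = p.
Hypothesis p_stable : derive1 (mean_field beta gamma) p < 1.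

Lemma sigmoid_near_fixed (e : R) : 0 <= e ->
  sigmoid (beta + gamma * (p ^+ 2 + e)) <= p + gamma * e /\
  p - gamma * e <= sigmoid (beta + gamma * (p ^+ 2 - e)).
Proof.
move=> e0; have pE : sigmoid (beta + gamma * p ^+ 2) = p by exact: p_fixed.
have ge0 : 0 <= gamma * e by rewrite mulr_ge0// ltW.
have /andP[_ h1] := @sigmoid_diff R (beta + gamma * p ^+ 2)
  (beta + gamma * (p ^+ 2 + e)) ltac:(lra).
have /andP[_ h2] := @sigmoid_diff R (beta + gamma * (p ^+ 2 - e))
  (beta + gamma * p ^+ 2) ltac:(lra).
by rewrite pE in h1 h2; split; lra.
Qed.

(** The extremal codegrees are squeezed towards [p ^ 2 * n]; this fixes all
    conditional probabilities, and with them the degrees, up to the same error.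
    The last factor [ln n] absorbs the constants that depend on [gamma]. *)
Lemma typical_regular : \forall n \near \oo, forall x : graph n,
  typical beta gamma x -> regular p (Num.sqrt n%:R * ln n%:R ^+ 2) x.
Proof.
have [K K0 sandwich] :=
  mean_field_sandwich gamma_gt0 p_gt0 p_lt1 p_fixed p_unique p_stable.
have gK0 : 0 < gamma * K by rewrite mulr_gt0.
near=> n => x /andP[/forallP T1 /forallP T2].
have n2 : (1 < n)%N by near: n; exact: nbhs_infty_ge.
have l1 : 1 <= ln (n%:R : R) by near: n; exact: near_ln_ge.
have lK : 4 * K + 4 * (gamma * K) + 2 <= ln (n%:R : R).
  by near: n; exact: near_ln_ge.
have n0 : 0 < n%:R :> R by rewrite ltr0n ltnW.
set t := Num.sqrt n%:R * ln n%:R in T1 T2.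
have s1 : 1 <= Num.sqrt n%:R :> R.
  by rewrite -[X in X <= _]sqrtr1 ler_wsqrtr// ler1n ltnW.
have t1 : 1 <= t by rewrite /t; apply: le_trans l1 _; rewrite ler_peMl//; lra.
have T2' i j : i != j ->
    `|residual beta gamma (fun k y => adjr R y j k) i x| <= t.
  by move=> ij; have /forallP/(_ j) := T2 i; rewrite ij.
have -> : Num.sqrt n%:R * ln n%:R ^+ 2 = t * ln n%:R by rewrite /t expr2 mulrA.
pose eta := 4 * t / n%:R.
have eta0 : 0 <= eta by rewrite divr_ge0 ?mulr_ge0//; lra.
have etan : eta * n%:R = 4 * t by rewrite /eta; field; lra.
pose u0 : 'I_n * 'I_n := (Ordinal (ltnW n2), Ordinal n2).
have Pu0 : u0.1 != u0.2 by [].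
pose cd (u : 'I_n * 'I_n) := codegree R x u.1 u.2.
have [[a b] /= ab max_ab] :=
  @arg_maxP _ _ _ u0 (fun u : 'I_n * 'I_n => u.1 != u.2) cd Pu0.
have [[c d] /= cd' min_cd] :=
  @arg_minP _ _ _ u0 (fun u : 'I_n * 'I_n => u.1 != u.2) cd Pu0.
have range u : 0 <= cd u / n%:R <= 1.
  have /andP[h0 h1] := codegree_bound R x u.1 u.2.
  by rewrite divr_ge0//= ler_pdivrMr// mul1r.
pose M := cd (a, b) / n%:R; pose m := cd (c, d) / n%:R.
have codegM i j : i != j -> codegree R x i j <= M * n%:R.
  by move=> ij; rewrite /M divfK ?gt_eqF//; exact: (max_ab (i, j)).
have codegm i j : i != j -> m * n%:R <= codegree R x i j.
  by move=> ij; rewrite /m divfK ?gt_eqF//; exact: (min_cd (i, j)).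
have Mp : M <= p ^+ 2 + K * eta.
  have /andP[r0 r1] := range (a, b).
  apply: (sandwich M eta r0 r1 eta0).1.
  rewrite /M ler_pdivrMr// mulrDl etan.
  have := codegree_max_le n2 t1 T1 T2' ab codegM.
  by rewrite /M /cd /=; lra.
have mp : p ^+ 2 - K * eta <= m.
  have /andP[r0 r1] := range (c, d).
  apply: (sandwich m eta r0 r1 eta0).2.
  rewrite /m ler_pdivlMr// mulrBl etan.
  exact: (codegree_min_ge n2 t1 T1 T2' cd' codegm).
have Ke0 : 0 <= K * eta by rewrite mulr_ge0// ltW.
have KeE : K * eta * n%:R = 4 * (K * t) by rewrite -mulrA etan; ring.
have gKeE : gamma * (K * eta) * n%:R = 4 * (gamma * K * t).
  by rewrite -mulrA KeE; ring.
have tl := ler_wpM2l (_ : 0 <= t) lK.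
have {}tl : t * (4 * K + 4 * (gamma * K) + 2) <= t * ln n%:R by apply: tl; lra.
have t0 : 0 <= t by exact: le_trans t1.
have Kt0 : 0 <= K * t by exact: mulr_ge0 (ltW K0) t0.
have gKt0 : 0 <= gamma * K * t by exact: mulr_ge0 (ltW gK0) t0.
have [sM sm] := sigmoid_near_fixed Ke0.
split=> [i|i j ij]; rewrite ler_norml; apply/andP; split.
- have : sigmoid (beta + gamma * (p ^+ 2 - K * eta)) * n%:R - t - 1 <=
      degree R x i.
    apply: degree_ge => // k ki; apply: le_trans (codegm i k _).
      by rewrite ler_wpM2r.
    by rewrite eq_sym.
  have := ler_wpM2r (ltW n0) sm; rewrite mulrBl gKeE; lra.
- have : degree R x i <=
      sigmoid (beta + gamma * (p ^+ 2 + K * eta)) * n%:R + t.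
    apply: degree_le => // k ki; apply: le_trans (codegM i k _) _.
      by rewrite eq_sym.
    by rewrite ler_wpM2r.
  have := ler_wpM2r (ltW n0) sM; rewrite mulrDl gKeE; lra.
- have := ler_wpM2r (ltW n0) mp; rewrite mulrBl KeE.
  have := codegm _ _ ij; lra.
- have := ler_wpM2r (ltW n0) Mp; rewrite mulrDl KeE.
  have := codegM _ _ ij; lra.
Unshelve. all: by end_near. Qed.

End TypicalRegular.

(** * Induced counts in regular graphs *)

Lemma ffact_le_expn (n s : nat) : (n ^_ s <= n ^ s)%N.
Proof.
by elim: s => [|s IH] //; rewrite ffactnSr expnSr leq_mul// leq_subr.
Qed.

Section RegularCounts.
Variable R : realType.

Lemma bernoulli_sub (e : R) (k : nat) : 0 <= e -> e <= 1 ->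
  1 - k%:R * e <= (1 - e) ^+ k.
Proof.
move=> e0 e1; elim: k => [|k IH]; first by rewrite mul0r subr0 expr0.
rewrite exprSr; apply: le_trans (ler_wpM2r _ IH); last lra.
have : 0 <= k%:R * e * e by rewrite !mulr_ge0.
rewrite -(natr1 k); lra.
Qed.

Lemma expr_add1_le (e z : R) (k : nat) : 0 <= e -> e <= 1 -> k%:R * e <= z -> z < 1 ->
  (1 + e) ^+ k <= (1 - z)^-1.
Proof.
move=> e0 e1 kz z1; rewrite -div1r ler_pdivlMr ?subr_gt0//.
apply: le_trans (_ : (1 + e) ^+ k * (1 - e) ^+ k <= _).
  apply: ler_wpM2l; first by apply: exprn_ge0; lra.
  by apply: le_trans (bernoulli_sub k e0 e1); lra.
rewrite -exprMn; apply: exprn_ile1; first by apply: mulr_ge0; lra.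
have : 0 <= e * e by rewrite mulr_ge0.
lra.
Qed.

Lemma ffact_ge (n s : nat) : (s <= n)%N -> (0 < n)%N ->
  n%:R ^+ s * (1 - s%:R ^+ 2 / n%:R) <= (n ^_ s)%:R :> R.
Proof.
move=> + n0; have n0' : 0 < n%:R :> R by rewrite ltr0n.
elim: s => [|s IH] sn; first by rewrite expr0 expr0n mul0r subr0 mul1r.
have := IH (ltnW sn) => {}IH.
rewrite ffactnSr natrM natrB ?(ltnW sn)//.
have ns0 : 0 <= n%:R - s%:R :> R by rewrite subr_ge0 ler_nat ltnW.
apply: le_trans (ler_wpM2r ns0 IH).
have -> : n%:R ^+ s * (1 - s%:R ^+ 2 / n%:R) * (n%:R - s%:R) =
  n%:R ^+ s.+1 * ((1 - s%:R ^+ 2 / n%:R) * (1 - s%:R / n%:R)) :> R.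
  by rewrite [n%:R ^+ s.+1]exprSr; field; rewrite gt_eqF.
rewrite ler_wpM2l ?exprn_ge0//.
have -> : s.+1%:R = s%:R + 1 :> R by rewrite natr1.
set a : R := s%:R; set b := n%:R^-1.
have a0 : 0 <= a by rewrite /a.
have b0 : 0 <= b by rewrite invr_ge0.
have : 0 <= a ^+ 3 * b ^+ 2 by rewrite mulr_ge0 ?exprn_ge0.
have : 0 <= a * b by rewrite mulr_ge0.
lra.
Qed.

Variable p : R.
Hypothesis p_gt0 : 0 < p.
Hypothesis p_lt1 : p < 1.

Lemma colour_weight_gt0 s (c : 'I_s -> 'I_s -> bool) :
  0 < colour_weight (colour_prob p) c.
Proof.
apply: prodr_gt0 => i _; apply: prodr_gt0 => j _.
by rewrite /colour_prob; case: (c i j); rewrite ?subr_gt0.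
Qed.

Lemma embeddings_bounds (n s : nat) (x : graph n) (H : graph s)
    (delta q eps h : R) :
  0 <= delta -> regular p delta x ->
  0 < q -> (forall c, q <= colour_prob p c) ->
  0 < eps -> eps < 1 -> 0 < h -> 2 <= eps * q * h ->
  s%:R * irregular_bound delta n q eps h <= eps * h ->
  h <= n%:R * ((1 - eps) * q) ^+ s ->
  let main := n%:R ^+ s * colour_weight (colour_prob p) (adj H) in
  (1 - eps) ^+ (s ^ 2) * main <= #|embeddings x H|%:R /\
  #|embeddings x H|%:R <= (1 + eps) ^+ (s ^ 2) * main.
Proof.
move=> d0 x_reg q0 q_le e0 e1 h0 eqh few hn main.
have P_bound c : q <= colour_prob p c <= 1.
  rewrite q_le /colour_prob; have := p_gt0; have := p_lt1.
  by case: c => /= ? ?; lra.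
have prodE : \prod_(j < s) (n%:R : R) = n%:R ^+ s by rewrite prodr_const card_ord.
rewrite embeddings_placements /main mulrA mulrA -prodE; split.
  apply: (placements_ge q0 P_bound e0 e1 (ltW h0) (irregular_bound_ge0 n d0 q eps h0)
    (few_irregular_vertices p_gt0 p_lt1 d0 x_reg q0 q_le e0 h0 eqh)) => // j.
  by rewrite cardsT card_ord.
apply: (placements_le q0 P_bound e0 e1 (ltW h0) (irregular_bound_ge0 n d0 q eps h0)
  (few_irregular_vertices p_gt0 p_lt1 d0 x_reg q0 q_le e0 h0 eqh)) => // j.
by rewrite cardsT card_ord.
Qed.

(** Here [E] counts labelled copies, [N] is the power [n ^ s] and [F] the
    falling factorial in the expectation. *)
Lemma ratio_deviation (E N F W a b z : R) :
  0 < F -> 0 < W -> F <= N -> 0 <= z -> z <= 1 / 2 ->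
  N * (1 - z) <= F -> 1 - z <= a -> b <= (1 - z)^-1 -> 0 <= a ->
  a * (N * W) <= E -> E <= b * (N * W) ->
  `|E / (F * W) - 1| <= 8 * z.
Proof.
move=> F0 W0 FN z0 z2 NF za bz a0 lo hi.
have FW : 0 < F * W by rewrite mulr_gt0.
have z1 : 0 < 1 - z by lra.
have lo' : 1 - z <= E / (F * W).
  rewrite ler_pdivlMr//; apply: le_trans lo.
  apply: ler_pM => //; [lra | exact: ltW | by rewrite ler_wpM2r// ltW].
have hi' : E / (F * W) <= (1 - z)^-1 * (1 - z)^-1.
  rewrite ler_pdivrMr//; apply: le_trans hi _.
  have NW : N * W <= (1 - z)^-1 * (F * W).
    rewrite mulrA ler_wpM2r ?(ltW W0)// mulrC ler_pdivlMr//.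
  rewrite -mulrA; apply: le_trans (ler_wpM2r _ bz) _.
    by rewrite mulr_ge0 ?(ltW W0)// (le_trans (ltW F0)).
  by rewrite ler_wpM2l// invr_ge0 ltW.
have inv_le : (1 - z)^-1 <= 1 + 2 * z.
  rewrite -div1r ler_pdivrMr//.
  have : 0 <= z * (1 - 2 * z) by rewrite mulr_ge0//; lra.
  lra.
have inv0 : 0 <= (1 - z)^-1 by rewrite invr_ge0 ltW.
have sq_le : (1 - z)^-1 * (1 - z)^-1 <= (1 + 2 * z) * (1 + 2 * z).
  by apply: ler_pM.
have : 0 <= z * (1 - 2 * z) by rewrite mulr_ge0//; lra.
by move=> zz; rewrite ler_norml; apply/andP; split; lra.
Qed.

Lemma gamma_of_ge2 : 2 <= gamma_of p.
Proof.
rewrite /gamma_of le_max; have := p_gt0; have := p_lt1 => p1 p0.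
have [ph|ph] := leP p (1 / 2); apply/orP; [left|right].
  by rewrite -div1r ler_pdivlMr//; lra.
by rewrite -div1r ler_pdivlMr ?subr_gt0//; lra.
Qed.

Lemma gamma_of_inv_le c : (gamma_of p)^-1 <= colour_prob p c.
Proof.
have g0 : 0 < gamma_of p by apply: lt_le_trans gamma_of_ge2.
case: c; rewrite /= -[leRHS]invrK lef_pV2 ?posrE ?invr_gt0 ?subr_gt0//.
  by rewrite /gamma_of le_max lexx.
by rewrite /gamma_of le_max lexx orbT.
Qed.

Lemma ln_gamma_of_ge : 1 / 2 <= ln (gamma_of p).
Proof.
rewrite -[leLHS]expRK ler_ln ?posrE ?expR_gt0//; last first.
  by apply: lt_le_trans gamma_of_ge2.
apply: le_trans gamma_of_ge2.
have := expR_ge1Dx (- (1 / 2) : R); rewrite expRN => h.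
have e0 := expR_gt0 (1 / 2 : R).
have := ler_wpM2r (ltW e0) h; rewrite mulVf ?gt_eqF//; lra.
Qed.

(** The exponent 13 leaves room for the error terms of size [ln n ^ k] in the
    number of exceptional vertices at all [s] steps. *)
Definition size_const : R := 13 / ln (gamma_of p).

Lemma size_const_gt0 : 0 < size_const.
Proof. by rewrite divr_gt0//; apply: lt_le_trans ln_gamma_of_ge; lra. Qed.

(** With [q] the inverse of [gamma_of p], a candidate set keeps at least about
    [n * q ^ s] elements after all [s] steps; by the second inequality this is
    at least [sqrt n * ln n ^ 13]. *)
Lemma size_bound_pow (n s : nat) : (0 < n)%N -> 1 <= ln (n%:R : R) ->
  s%:R <= size_bound p size_const n ->
  s%:R <= ln (n%:R : R) /\
  ln (n%:R : R) ^+ 13 <= Num.sqrt n%:R * (gamma_of p)^-1 ^+ s.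
Proof.
move=> n0; set l := ln n%:R => l1 sl.
have g2 := gamma_of_ge2; have lg := ln_gamma_of_ge.
have g0 : 0 < gamma_of p by lra.
have lg0 : 0 < ln (gamma_of p) by lra.
have ll0 : 0 <= ln l by exact: ln_ge0.
have C0 : 0 <= size_const * ln l by rewrite mulr_ge0// ltW// size_const_gt0.
have sl' : s%:R * ln (gamma_of p) <= l / 2 - 13 * ln l.
  rewrite -ler_pdivlMr//; apply: le_trans sl _.
  rewrite le_eqVlt; apply/orP; left; apply/eqP.
  by rewrite /size_bound -/l /size_const; field; rewrite gt_eqF.
split.
  have s0 : 0 <= s%:R :> R by [].
  have : 0 <= s%:R * (ln (gamma_of p) - 1 / 2) by rewrite mulr_ge0// subr_ge0.
  lra.
have nE : Num.sqrt n%:R = expR (l / 2).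
  have -> : n%:R = expR (l / 2) ^+ 2.
    rewrite -expRM_natl (_ : 2%:R * (l / 2) = l); last by lra.
    by rewrite lnK// posrE ltr0n.
  by rewrite sqrtr_sqr ger0_norm// expR_ge0.
have lE : l ^+ 13 = expR (13 * ln l).
  by rewrite expRM_natl lnK// posrE; lra.
have gE : gamma_of p ^+ s = expR (s%:R * ln (gamma_of p)).
  by rewrite expRM_natl lnK// posrE.
rewrite exprVn nE lE ler_pdivlMr ?exprn_gt0// gE -expRD ler_expR; lra.
Qed.

Lemma regular_max_deviation : \forall n \near \oo, forall x : graph n,
  regular p (Num.sqrt n%:R * ln n%:R ^+ 2) x ->
  0 <= max_deviation p size_const x <= 8 / ln n%:R.
Proof.
set q := (gamma_of p)^-1.
have g0 : 0 < gamma_of p by apply: lt_le_trans gamma_of_ge2.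
have q0 : 0 < q by rewrite invr_gt0.
near=> n => x x_reg.
have n0 : (0 < n)%N by near: n; exact: nbhs_infty_ge.
have l24 : 24 <= ln (n%:R : R) by near: n; exact: near_ln_ge.
have lq : 4 / q <= ln (n%:R : R) by near: n; exact: near_ln_ge.
have lq2 : 40 / q ^+ 2 <= ln (n%:R : R) by near: n; exact: near_ln_ge.
set l := ln n%:R in l24 lq lq2 x_reg *.
set y := Num.sqrt n%:R in x_reg.
have n0' : 0 < n%:R :> R by rewrite ltr0n.
have l0 : 0 < l by lra.
have l1 : 1 <= l by lra.
have y1 : 1 <= y by rewrite -[leLHS]sqrtr1 ler_wsqrtr// ler1n.
have y0 : 0 < y by lra.
have nE : n%:R = y ^+ 2 by rewrite sqr_sqrtr.
have l3n : l ^+ 3 <= n%:R.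
  have nl : n%:R = expR l by rewrite lnK.
  rewrite nl; apply: le_trans (_ : 1 + l ^+ 4 / 4`!%:R <= _); last first.
    by apply: expR_ge1Dxn; exact: ltW.
  have : 0 <= l ^+ 3 * (l - 24) by rewrite mulr_ge0 ?exprn_ge0 ?subr_ge0// ltW.
  rewrite (_ : 4`!%:R = 24 :> R)//; lra.
have term (s : nat) (H : graph s) : (0 < s)%N ->
    s%:R <= size_bound p size_const n ->
    `|(induced_count x H)%:R / er_expected_count p n H - 1| <= 8 / l.
  move=> s0 sb; have [sl lqs] := size_bound_pow n0 l1 sb.
  rewrite -/l -/y -/q in sl lqs.
  (* The total relative error is about [s ^ 2 * eps <= 1 / l]; [h] is half of
     the smallest candidate set, to leave room for the factor [(1 - eps) ^ s]. *)
  pose eps := (l ^+ 3)^-1; pose h := y * l ^+ 13 / 2.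
  have l3 : 0 < l ^+ 3 by rewrite exprn_gt0.
  have e0 : 0 < eps by rewrite invr_gt0.
  have le : l ^+ 3 * eps = 1 by rewrite divff// gt_eqF.
  have s00 : 0 <= s%:R :> R by [].
  have s2l : s%:R ^+ 2 <= l ^+ 2 by rewrite lerXn2r ?nnegrE// ltW.
  have linv : l ^+ 2 * eps = l^-1 by rewrite /eps; field; rewrite gt_eqF.
  have s2e : (s ^ 2)%N%:R * eps <= l^-1.
    by rewrite -linv natrX ler_wpM2r// ltW.
  have linv24 : l^-1 <= 1 / 24 by rewrite div1r lef_pV2 ?posrE//; lra.
  have linv0 : 0 < l^-1 by rewrite invr_gt0.
  have se : s%:R * eps <= 1 / 2.
    apply: le_trans (_ : (s ^ 2)%N%:R * eps <= _); last by lra.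
    rewrite ler_wpM2r ?(ltW e0)// ler_nat -mulnn leq_pmulr//.
  have e1 : eps < 1 by rewrite invf_lt1// exprn_egt1//; lra.
  have h0 : 0 < h by rewrite divr_gt0// mulr_gt0// exprn_gt0.
  have eh : eps * h = y * l ^+ 10 / 2.
    by rewrite /eps /h; field; rewrite gt_eqF.
  have l10 : l <= l ^+ 10 by rewrite -[leLHS]expr1 ler_weXn2l.
  have eqh : 2 <= eps * q * h.
    have -> : eps * q * h = q * y * l ^+ 10 / 2 by rewrite mulrAC eh; ring.
    have lq' : 4 <= l * q by rewrite -ler_pdivrMr.
    have : 4 * 1 <= q * l ^+ 10 * y.
      apply: ler_pM => //; apply: le_trans lq' _.
      by rewrite mulrC ler_wpM2l// ltW.
    lra.
  have few : s%:R * irregular_bound (y * l ^+ 2) n q eps h <= eps * h.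
    rewrite /irregular_bound.
    have nh : n%:R / h <= 2 * (y * l ^+ 2).
      rewrite ler_pdivrMr// nE /h.
      have -> : 2 * (y * l ^+ 2) * (y * l ^+ 13 / 2) = y ^+ 2 * l ^+ 15 by field.
      by rewrite ler_peMr ?sqr_ge0// exprn_ege1.
    have kap_le : 4 * (n%:R / h + 3 * (y * l ^+ 2)) / (eps * q) ^+ 2 <=
        20 * (y * l ^+ 2) / (eps * q) ^+ 2.
      by rewrite ler_wpM2r ?invr_ge0 ?sqr_ge0//; lra.
    apply: le_trans (ler_wpM2l s00 kap_le) _.
    apply: le_trans (ler_wpM2r _ sl) _.
      by rewrite divr_ge0 ?sqr_ge0// !mulr_ge0 ?sqr_ge0// ltW.
    have -> : l * (20 * (y * l ^+ 2) / (eps * q) ^+ 2) =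
        40 / q ^+ 2 * (y * l ^+ 9 / 2).
      by rewrite /eps; field; rewrite !gt_eqF.
    rewrite eh (_ : y * l ^+ 10 / 2 = l * (y * l ^+ 9 / 2)); last by ring.
    by rewrite ler_wpM2r// divr_ge0// mulr_ge0 ?exprn_ge0 ?(ltW y0) ?(ltW l0).
  have hn : h <= n%:R * ((1 - eps) * q) ^+ s.
    rewrite exprMn.
    apply: le_trans (_ : n%:R * (1 / 2 * q ^+ s) <= _); last first.
      rewrite ler_wpM2l// ler_wpM2r ?exprn_ge0 ?(ltW q0)//.
      by apply: le_trans (bernoulli_sub s (ltW e0) (ltW e1)); lra.
    have := ler_wpM2l (ltW y0) lqs; rewrite nE /h; lra.
  have [lo hi] := embeddings_bounds H (mulr_ge0 (ltW y0) (sqr_ge0 l)) x_reg q0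
    gamma_of_inv_le e0 e1 h0 eqh few hn.
  have sn : (s <= n)%N.
    rewrite -(ler_nat R); apply: le_trans sl _; apply: le_trans l3n.
    by rewrite -[leLHS]expr1 ler_weXn2l.
  have s2n : s%:R ^+ 2 / n%:R <= l^-1.
    rewrite ler_pdivrMr//; apply: le_trans s2l _.
    by rewrite mulrC ler_pdivlMr// -exprSr.
  rewrite induced_count_ratio.
  apply: (ratio_deviation (N := n%:R ^+ s) (a := (1 - eps) ^+ (s ^ 2))
    (b := (1 + eps) ^+ (s ^ 2))) => //.
  - by rewrite ltr0n ffact_gt0.
  - exact: colour_weight_gt0.
  - by rewrite -natrX ler_nat ffact_le_expn.
  - exact: ltW.
  - lra.
  - apply: le_trans (ffact_ge sn n0); rewrite ler_wpM2l ?exprn_ge0//; lra.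
  - by apply: le_trans (bernoulli_sub (s ^ 2) (ltW e0) (ltW e1)); lra.
  - by apply: expr_add1_le; rewrite ?(ltW e0) ?(ltW e1)//; lra.
  - by apply: exprn_ge0; lra.
have b0 : 0 <= 8 / l by rewrite divr_ge0// ltW.
rewrite /max_deviation big_nat; apply/andP; split.
  elim/big_ind: _ => [//|a b ha hb|s _]; first by rewrite le_max ha.
  by elim/big_ind: _ => [//|a b ha hb|H _] //; rewrite le_max ha.
elim/big_ind: _ => [//|a b ha hb|s /andP[s0 sb]]; first by rewrite ge_max ha.
elim/big_ind: _ => [//|a b ha hb|H _]; first by rewrite ge_max ha.
apply: term => //.
have B1 : 1 <= size_bound p size_const n.
  rewrite -truncn_gt0; exact: leq_trans s0 _.
apply: le_trans (_ : (Num.truncn (size_bound p size_const n))%:R <= _).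
  by rewrite ler_nat.
by rewrite truncn_le//; lra.
Unshelve. all: by end_near. Qed.

End RegularCounts.

(** * Almost sure convergence *)

Section AlmostSure.
Variables (R : realType) (beta gamma : R).
Variables (d : measure_display) (T : measurableType d) (P : probability T R).
Variable X : forall n : nat, T -> graph n.
Hypothesis X_law : forall (n : nat) (x : graph n), (0 < n)%N ->
  measurable (X n @^-1` [set x]) /\
  P (X n @^-1` [set x]) = (ergm beta gamma x)%:E.

Lemma law_pred (n : nat) (b : pred (graph n)) : (0 < n)%N ->
  measurable [set w | b (X n w)] /\
  (P [set w | b (X n w)] <= (\sum_(x | b x) ergm beta gamma x)%:E)%E.
Proof.
move=> n0.
have -> : [set w | b (X n w)] = \big[setU/set0]_(x | b x) X n @^-1` [set x].
  rewrite -bigcup_seq_cond; apply/seteqP; split=> w /=.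
    by move=> bw; exists (X n w) => //=; rewrite mem_index_enum bw.
  by move=> [x /= /andP[_ bx] xw]; rewrite xw.
apply: (big_rec2 (fun (A : set T) (r : R) => measurable A /\ (P A <= r%:E)%E)).
  by split => //; rewrite measure0.
move=> x A r bx [mA PA].
have [mx Px] := X_law x n0; split; first exact: measurableU.
apply: le_trans (measureU2 P mx mA) _.
by rewrite EFinD -Px leeD.
Qed.

(** The first Borel-Cantelli lemma, with a bound that telescopes so that the
    partial sums are explicit. *)
Lemma ae_eventually (bad : forall n, pred (graph n)) :
  (\forall n \near \oo, \sum_(x : graph n | bad n x) ergm beta gamma x <=
     n%:R^-1 - n.+1%:R^-1) ->
  {ae P, forall w, \forall n \near \oo, ~~ bad n (X n w)}.
Proof.
move=> [N _ HN].
pose F (n : nat) := if (N <= n)%N && (0 < n)%N then [set w | bad n (X n w)] else set0.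
have mF n : measurable (F n).
  by rewrite /F; case: ifP => // /andP[_ n0]; have [] := law_pred (bad n) n0.
have PF n : (P (F n.+1) <= (n.+1%:R^-1 - n.+2%:R^-1)%:E)%E.
  rewrite /F; case: ifP => [/andP[Nn n0]|_].
    have [_ h] := law_pred (bad n.+1) n0; apply: le_trans h _.
    by rewrite lee_fin; exact: HN.
  by rewrite measure0 lee_fin subr_ge0 lef_pV2 ?posrE// ler_nat.
have partial k : (\sum_(0 <= i < k.+1) P (F i) <= (1 - k.+1%:R^-1)%:E)%E.
  elim: k => [|k IH].
    by rewrite big_nat1 /F andbF measure0 invr1 subrr.
  rewrite big_nat_recr//=; apply: le_trans (leeD IH (PF k)) _.
  by rewrite -EFinD lee_fin addrA subrK.
have sum_fin : (\sum_(n <oo) P (F n) < +oo)%E.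
  apply: le_lt_trans (ltry 1); apply: lime_le; first exact: is_cvg_nneseries.
  apply: nearW => -[|k]; first by rewrite big_geq// lee_fin.
  by apply: le_trans (partial k) _; rewrite lee_fin gerBl invr_ge0.
exists (lim_sup_set F); split.
- by apply: bigcap_measurable => // k _; apply: bigcup_measurable => j _; exact: mF.
- exact: lim_sup_set_cvg0.
- move=> w /= nw k _; apply: contrapT => no_bad; apply: nw.
  exists (maxn k (maxn N 1)) => // j /= kj; apply/negP => bj; apply: no_bad.
  exists j => /=; first by rewrite (leq_trans _ kj)// leq_maxl.
  rewrite /F ifT//.
  by move: kj; rewrite !geq_max => /and3P[_ -> ->].
Qed.

End AlmostSure.

Unset Implicit Arguments.

Theorem theorem2p2 (R : realType) (p : R) (p_gt0 : 0 < p) (p_lt1 : p < 1) :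
  exists C : R, 0 < C /\
    forall beta gamma : R,
      0 < gamma ->
      mean_field beta gamma p = p ->
      (forall q : R, 0 < q -> q < 1 -> mean_field beta gamma q = q -> q = p) ->
      derive1 (mean_field beta gamma) p < 1 ->
      forall (d : measure_display) (T : measurableType d) (P : probability T R)
        (X : forall n : nat, T -> graph n),
        (forall (n : nat) (x : graph n), (0 < n)%N ->
           measurable (X n @^-1` [set x]) /\
           P (X n @^-1` [set x]) = (ergm beta gamma x)%:E) ->
        {ae P, forall w : T,
           (fun n : nat => max_deviation p C (X n w)) @ \oo --> (0 : R)}.
Proof.
exists (size_const p); split; first exact: size_const_gt0.
move=> beta gamma gamma_gt0 p_fixed p_unique p_stable d T P X X_law.
have typ := typical_regular gamma_gt0 p_gt0 p_lt1 p_fixed p_unique p_stable.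
have dev := regular_max_deviation p_gt0 p_lt1.
have := ae_eventually X_law (atypical_prob beta (ltW gamma_gt0)).
apply: filterS => w ev; apply/cvgrPdist_le => e e0; near=> n.
have x_typ : typical beta gamma (X n w) by rewrite -[typical _ _ _]negbK; near: n.
have x_reg : regular p (Num.sqrt n%:R * ln n%:R ^+ 2) (X n w).
  by move: (X n w) x_typ; near: n.
have /andP[lo hi] : 0 <= max_deviation p (size_const p) (X n w) <= 8 / ln n%:R.
  by move: (X n w) x_reg {x_typ}; near: n.
rewrite sub0r normrN ger0_norm//; apply: le_trans hi _.
have l1 : 1 <= ln (n%:R : R) by near: n; exact: near_ln_ge.
have le : 8 / e <= ln (n%:R : R) by near: n; exact: near_ln_ge.
by rewrite ler_pdivrMr ?(lt_le_trans ltr01)// mulrC -ler_pdivrMr.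
Unshelve. all: by end_near. Qed.
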